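(* Let $k\in\mathbb N$, $k\ge2$, let $E$ be a symmetric space with the Fatou property and let $x\in S_E$. The following conditions are equivalent. (i) $x$ is a point of local fully $k$-rotundity of $E$. (ii) $|x|$ is a point of local fully $k$-rotundity of $E$. (iii) $x^*$ is a point of local fully $k$-rotundity of $E$.
   Context: Let $I=[0,\alpha)$, $\alpha=1$ or $\alpha=\infty$, with Lebesgue measure $\mu$, and $L^0$ the set of (classes of) extended real valued measurable functions on $I$. A Banach function space $(E,\|\cdot\|_E)$ is a Banach lattice that is a sublattice of $L^0$ such that (1) if $x\in L^0$, $y\in E$, $|x|\le|y|$ a.e., then $x\in E$ and $\|x\|_E\le\|y\|_E$; (2) there is a strictly positive $x\in E$. $E^+=\{x\in E:x\ge0\}$; $S_E$ is the unit sphere. Fatou property: if $(x_n)\subset E^+$, $\sup_n\|x_n\|_E<\infty$ and $x_n\uparrow x\in L^0$, then $x\in E$ and $\|x_n\|_E\uparrow\|x\|_E$. For $x\in L^0$: $d_x(\lambda)=\mu\{s\in I:|x(s)|>\lambda\}$ and $x^*(t)=\inf\{\lambda>0:d_x(\lambda)\le t\}$. A symmetric space is a Banach function space $E$ such that $x\in L^0$, $y\in E$, $d_x=d_y$ imply $x\in E$ and $\|x\|_E=\|y\|_E$. A point $x\in S_E$ is a point of local fully $k$-rotundity if for every sequence $(x_n)\subset S_E$ such that $\|x+\sum_{i=1}^k x_{n,i}\|_E\to k+1$ as $n\to\infty$ for any $k$ subsequences $(x_{n,1})_n,\dots,(x_{n,k})_n$ of $(x_n)$, one has $\|x_n-x\|_E\to0$.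 *)

(* Defs.v *)
From HB Require Import structures.
From mathcomp Require Import all_boot all_order all_algebra.
From mathcomp Require Import all_classical all_reals all_analysis measurable_realfun.

Set Implicit Arguments.
Unset Strict Implicit.
Unset Printing Implicit Defensive.

Import Order.TTheory GRing.Theory Num.Theory.
Import numFieldNormedType.Exports.

Local Open Scope classical_set_scope.
Local Open Scope ring_scope.

Definition interval_to {R : realType} (alpha : \bar R) : set R :=
  [set t | 0 <= t /\ (t%:E < alpha)%E].

Definition d_ {R : realType} (I : set R) (f : R -> \bar R) (lambda : R) :
    \bar R :=
  lebesgue_measure [set s | I s /\ (lambda%:E < `|f s|)%E].

(* The infimum of the empty set is +oo. *)
Definition rearr {R : realType} (I : set R) (f : R -> \bar R) (t : R) :
    \bar R :=
  ereal_inf [set lambda%:E | lambda in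
    [set lambda : R | 0 < lambda /\ (d_ I f lambda <= t%:E)%E]].

(* A Banach function space on I is a Banach space together with an injection
   into the classes modulo a.e. equality of measurable functions I -> \bar R;
   [rep x] is a representative of the class of x (its values outside I are
   irrelevant).  The operations of the space are the pointwise ones a.e.
   Members of the space are then a.e. finite: see [rep_fin_num_ae]. *)
Record banach_function_space (R : realType) (I : set R) := BanachFunctionSpace {
  bfs_space :> completeNormedModType R ;
  rep : bfs_space -> R -> \bar R ;
  rep_measurable : forall x, measurable_fun I (rep x) ;
  rep_inj : forall x y, ae_eq lebesgue_measure I (rep x) (rep y) -> x = y ;
  repD : forall x y, ae_eq lebesgue_measure I
    (rep (x + y)) (fun t => rep x t + rep y t)%E ;
  repZ : forall (c : R) x, ae_eq lebesgue_measure I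
    (rep (c *: x)) (fun t => c%:E * rep x t)%E ;
  bfs_max : forall x y, exists z, ae_eq lebesgue_measure I
    (rep z) (fun t => maxe (rep x t) (rep y t)) ;
  bfs_min : forall x y, exists z, ae_eq lebesgue_measure I
    (rep z) (fun t => mine (rep x t) (rep y t)) ;
  bfs_ideal : forall (f : R -> \bar R) y, measurable_fun I f ->
    {ae lebesgue_measure, forall t, I t -> (`|f t| <= `|rep y t|)%E} ->
    exists x, ae_eq lebesgue_measure I (rep x) f /\ `|x| <= `|y| ;
  bfs_strictly_pos : exists x,
    {ae lebesgue_measure, forall t, I t -> (0 < rep x t)%E} }.

Arguments rep {R I b} x t.

Lemma rep_fin_num_ae (R : realType) (I : set R) (E : banach_function_space I)
  (x : E) : {ae lebesgue_measure, forall t, I t -> rep x t \is a fin_num}.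
Proof.
have := repD x (- x); rewrite subrr -(scale0r x) => xD.
have := repZ (-1) x; rewrite scaleN1r => xN.
move: xD (repZ 0 x) xN; apply: filterS3 => t xD x0 xN It.
move: (xD It); rewrite (x0 It) (xN It) mul0e EFinN mulN1e.
by case: (rep x t).
Qed.

Section properties.
Context {R : realType} {I : set R}.
Implicit Type E : banach_function_space I.

Definition fatou_property E : Prop :=
  forall (u : nat -> E) (f : R -> \bar R), measurable_fun I f ->
    (forall n, {ae lebesgue_measure, forall t, I t -> (0 <= rep (u n) t)%E}) ->
    (exists M : R, forall n, `|u n| <= M) ->
    (forall n, {ae lebesgue_measure, forall t, I t ->
      (rep (u n) t <= rep (u n.+1) t)%E}) ->
    {ae lebesgue_measure, forall t, I t -> rep (u n) t @[n --> \oo] --> f t} ->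
  exists x : E, [/\ ae_eq lebesgue_measure I (rep x) f,
    nondecreasing_seq (fun n => `|u n|) & `|u n| @[n --> \oo] --> `|x|].

Definition symmetric_space E : Prop :=
  forall (f : R -> \bar R) (y : E), measurable_fun I f ->
    (forall lambda : R, 0 <= lambda -> d_ I f lambda = d_ I (rep y) lambda) ->
  exists x : E, ae_eq lebesgue_measure I (rep x) f /\ `|x| = `|y|.

End properties.

(* The k subsequences are given by strictly increasing maps phi i. *)
Definition locally_fully_rotund_at (R : realType) (E : normedModType R)
    (k : nat) (x : E) : Prop :=
  `|x| = 1 /\
  forall u : nat -> E, (forall n, `|u n| = 1) ->
    (forall phi : 'I_k -> nat -> nat,
      (forall i, {homo phi i : m n / (m < n)%N}) ->
      `|x + \sum_(i < k) u (phi i n)| @[n --> \oo] --> (k.+1%:R : R)) ->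
  `|u n - x| @[n --> \oo] --> (0 : R).

(* The same for the class of a function f, which has to belong to E. *)
Definition fun_locally_fully_rotund_at (R : realType) (I : set R)
    (E : banach_function_space I) (k : nat) (f : R -> \bar R) : Prop :=
  exists y : E, ae_eq lebesgue_measure I (rep y) f /\
    locally_fully_rotund_at k y.

(* Main.v *)
(** The equivalence of (i) and (ii) is multiplication by the sign of x, an
    isometry that carries x to |x|.

    For (ii) => (iii), local rotundity at |x| and the Fatou property make the
    norm order continuous at |x|, so that x vanishes at infinity in measure.
    Then |x| = x^* o sigma for a measure preserving sigma (Ryff), and
    y |-> y o sigma is an isometric embedding carrying x^* to |x|.

    For (iii) => (ii), cut I into the level sets of |x| for a fine subdivision
    of the values, and replace a function y >= 0 by y', its decreasing
    rearrangement cell by cell, placed on the level sets of x^*; in particular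
    |x|' = x^*.  For finitely many nonnegative functions
    ||sum y_i|| <= ||sum y_i'||: if they are constant on finitely many pieces
    of equal measure, sorting the values amounts to undoing averages over
    transpositions of the pieces, and the general case follows by the Fatou
    property.  So if (y_n) tests rotundity at |x|, then (y_n') tests it at x^*
    and y_n' -> x^*.  Finally, for the step function c constant on the cells,
    |y_n - c| and |y_n' - c'| are equimeasurable, and c approximates |x|. *)
Require Import Defs.
From HB Require Import structures.
From mathcomp Require Import all_boot all_order all_algebra.
From mathcomp Require Import all_classical all_reals all_analysis measurable_realfun.
From mathcomp Require Import all_fingroup ring lra.

Import Order.TTheory GRing.Theory Num.Theory.
Import numFieldNormedType.Exports.

Local Open Scope classical_set_scope.
Local Open Scope ring_scope.

Local Notation mu := lebesgue_measure.

(** The composition isometry of the second implication cannot be reversed: it need not be onto, and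
    a sequence that tests rotundity at |x| need not be of the form w_n o sigma. Rearranging such a
    sequence globally would keep the norm inequality for sums, but the convergence of y_n^* to x^*
    says nothing about where y_n lives. Rearranging cell by cell keeps both kinds of information:
    sums do not lose norm, and distances to functions constant on the cells are preserved exactly,
    so closeness to x^* comes back up to the fineness of the subdivision.

    The thresholds are j / (m+1) for j <= (m+1)^2. The lowest cell, where |x| <= 1 / (m+1), can have
    infinite measure, but c is 0 there; the other cells have finite measure because x^* is a rotund
    point and the norm is order continuous at it. The same continuity makes c a good approximation.

    Two reductions come before this: test sequences may be taken in the unit ball instead of the
    sphere, and, at a nonnegative point, they may be taken nonnegative. *)

(** Bubble sort with maximality in place of a termination argument: among the label-preserving
    families [s] for which the implication holds, one that maximises [Phi] has no pair left in the
    wrong order. [Q] will say that a step function lies in a ball, and the labels keep each piece in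
    its cell. *)
Lemma convex_perm_sort (R : realType) (P K : finType) (L : eqType)
    (r : P -> nat) (lab : P -> L) (Q : (P -> R) -> Prop) (v : K -> P -> R) :
  (forall w w' t, Q w -> Q w' -> 0 <= t <= 1 ->
    Q (fun p => t * w p + (1 - t) * w' p)) ->
  (forall w p q, Q w -> Q (w \o tperm p q)) ->
  exists s : K -> {perm P}, [/\ forall k p, lab (s k p) = lab p,
    forall k p q, lab p = lab q -> (r p < r q)%N -> v k (s k q) <= v k (s k p) &
    Q (fun p => \sum_k v k (s k p)) -> Q (fun p => \sum_k v k p)].
Proof.
move=> Qconv Qperm.
pose ok (s : {ffun K -> {perm P}}) := `[< (forall k p, lab (s k p) = lab p) /\
  (Q (fun p => \sum_k v k (s k p)) -> Q (fun p => \sum_k v k p)) >].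
pose Phi (s : {ffun K -> {perm P}}) := \sum_k \sum_p v k (s k p) * - (r p)%:R.
have ok1 : ok [ffun=> 1%g].
  apply/asboolP; split=> [k p|]; first by rewrite ffunE perm1.
  by under eq_fun do under eq_bigr do rewrite ffunE perm1.
case: (@arg_maxP _ _ _ _ _ Phi ok1) => s /asboolP[lab_s Qs] smax.
exists s; split=> // k0 p q labpq rpq; rewrite leNgt; apply/negP => vpq.
have pq : p != q by apply: contraTneq rpq => ->; rewrite ltnn.
(* Order the entries at [p] and [q] for every [k] at once, so that the sum at [p] becomes the larger
   one while the total over the two places is unchanged. *)
pose s' : {ffun K -> {perm P}} :=
  [ffun k => if v k (s k p) < v k (s k q) then (tperm p q * s k)%g else s k].
have s'p k : v k (s' k p) = Num.max (v k (s k p)) (v k (s k q)).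
  by rewrite ffunE; case: ltP => // _; rewrite permM tpermL.
have s'q k : v k (s' k q) = Num.min (v k (s k p)) (v k (s k q)).
  by rewrite ffunE; case: ltP => // _; rewrite permM tpermR.
have s'x k x : x != p -> x != q -> s' k x = s k x.
  move=> xp xq; rewrite ffunE; case: ifP => // _.
  by rewrite permM tpermD // eq_sym.
have oks' : ok s'.
  apply/asboolP; split=> [k x|Qs'].
    rewrite ffunE; case: ifP => // _; rewrite permM lab_s.
    by case: tpermP => // ->.
  apply: Qs.
  set w' := (X in Q X) in Qs'.
  set w := (X in Q X).
  have wD : w p + w q = w' p + w' q.
    rewrite /w /w' -!big_split; apply: eq_bigr => k _.
    by rewrite /= s'p s'q addr_max_min.
  have w'pq : w' q < w' p.
    rewrite /w' (bigD1 k0) //= [ltRHS](bigD1 k0) //= ltr_leD //.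
      by rewrite s'p s'q minElt maxElt vpq.
    by apply: ler_sum => k _; rewrite s'p s'q ge_min !le_max lexx.
  have wp1 : w p <= w' p.
    by apply: ler_sum => k _; rewrite s'p le_max lexx.
  have wp2 : w' q <= w p.
    by apply: ler_sum => k _; rewrite s'q ge_min lexx.
  (* Since [w' q <= w p <= w' p] and [w p + w q = w' p + w' q], the vector [w] lies on the segment
     between [w'] and its transpose; [t] is its position there. *)
  pose t := (w p - w' q) / (w' p - w' q).
  have d0 : w' p - w' q != 0 by rewrite subr_eq0 gt_eqF.
  have tE : t * (w' p - w' q) = w p - w' q by rewrite divfK.
  have t01 : 0 <= t <= 1.
    by rewrite ler_pdivrMr ?mul1r ?divr_ge0; lra.
  have -> : w = (fun x => t * w' x + (1 - t) * (w' \o tperm p q) x).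
    apply/funext => x; have [->|xp] := eqVneq x p.
      by rewrite /= tpermL; lra.
    have [->|xq] := eqVneq x q; first by rewrite /= tpermR; lra.
    rewrite /= tpermD 1?eq_sym // -mulrDl subrKC mul1r.
    by apply: eq_bigr => k _; rewrite s'x.
  by apply: Qconv => //; exact: Qperm.
(* Ranks enter [Phi] with a minus sign, so moving a larger value to the smaller rank increases it,
   strictly for [k0]. *)
have : Phi s' <= Phi s by exact: smax oks'.
rewrite leNgt => /negP; apply.
have PhiE (s0 : {ffun K -> {perm P}}) k : \sum_x v k (s0 k x) * - (r x)%:R =
    v k (s0 k p) * - (r p)%:R + (v k (s0 k q) * - (r q)%:R +
    \sum_(x | (x != p) && (x != q)) v k (s0 k x) * - (r x)%:R).
  by rewrite (bigD1 p) //= (bigD1 q) // eq_sym.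
have rest k : \sum_(x | (x != p) && (x != q)) v k (s' k x) * - (r x)%:R =
    \sum_(x | (x != p) && (x != q)) v k (s k x) * - (r x)%:R.
  by apply: eq_bigr => x /andP[xp xq]; rewrite s'x.
have rr : 0 < (r q)%:R - (r p)%:R :> R by rewrite subr_gt0 ltr_nat.
rewrite /Phi (bigD1 k0) //= [ltRHS](bigD1 k0) //= ltr_leD //.
  by rewrite !PhiE rest s'p s'q minElt maxElt vpq; nra.
apply: ler_sum => k _; rewrite !PhiE rest s'p s'q.
by case: (ltP (v k (s k p)) (v k (s k q))) => vk; nra.
Qed.

(** * Almost everywhere equalities and the norm *)

Section almost_everywhere.
Context {R : realType}.
Implicit Types P Q S T : R -> Prop.

Lemma aeS P Q : (forall t, P t -> Q t) ->
  {ae mu, forall t, P t} -> {ae mu, forall t, Q t}.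
Proof.
move=> PQ aP; refine (@filterS _ _ (ae_filter_ringOfSetsType _) _ _ _ aP).
exact: PQ.
Qed.

Lemma aeS2 P Q S : (forall t, P t -> Q t -> S t) ->
  {ae mu, forall t, P t} -> {ae mu, forall t, Q t} -> {ae mu, forall t, S t}.
Proof.
move=> PQS aP aQ.
refine (@filterS2 _ _ (ae_filter_ringOfSetsType _) _ _ _ _ aP aQ).
exact: PQS.
Qed.

Lemma aeS3 P Q S T : (forall t, P t -> Q t -> S t -> T t) ->
  {ae mu, forall t, P t} -> {ae mu, forall t, Q t} -> {ae mu, forall t, S t} ->
  {ae mu, forall t, T t}.
Proof.
move=> PQST aP aQ aS.
refine (@filterS3 _ _ (ae_filter_ringOfSetsType _) _ _ _ _ _ aP aQ aS).
exact: PQST.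
Qed.

Lemma ae_forall_count (K : countType) (P : K -> R -> Prop) :
  (forall i, {ae mu, forall t, P i t}) -> {ae mu, forall t, forall i, P i t}.
Proof.
move=> aP.
have : {ae mu, forall t (n : nat), forall i, unpickle n = Some i -> P i t}.
  apply: ae_foralln => n; case: (unpickle n) => [i|]; last by apply: aeW.
  by apply: aeS (aP i) => t Pt _ [<-].
by apply: aeS => t H i; apply: (H (pickle i)); rewrite pickleK.
Qed.

Lemma le_lebesgue (A B : set R) : measurable A -> measurable B -> A `<=` B ->
  (mu A <= mu B)%E.
Proof. by move=> mA mB AB; apply: le_measure => //; exact/mem_set. Qed.

Lemma lebesgueU (A B : set R) : measurable A -> measurable B ->
  A `&` B = set0 -> mu (A `|` B) = (mu A + mu B)%E.
Proof. by move=> mA mB AB; rewrite measureU. Qed.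

Lemma lebesgueD (A B : set R) : measurable A -> measurable B -> B `<=` A ->
  (mu A < +oo)%E -> mu (A `\` B) = (mu A - mu B)%E.
Proof. by move=> mA mB BA Afin; rewrite measureD // setIidr. Qed.

End almost_everywhere.

(** * Real-valued representatives and closure properties of balls *)

Section real_representatives.
Context {R : realType} {I : set R}.
Hypothesis mI : measurable I.
Context {E : banach_function_space I}.
Implicit Types (x y : E) (f g : R -> R).

(** Members of the space are a.e. finite, so the value 0 that [fine] assigns to infinities matters
    only on a null set, and the rest can be done in real arithmetic. *)
Definition rrep x (t : R) : R := fine (rep x t).

Lemma rrepE x : {ae mu, forall t, I t -> rep x t = (rrep x t)%:E}.
Proof.
by apply: aeS (rep_fin_num_ae x) => t xt It /=; rewrite fineK ?xt.
Qed.

Lemma measurable_rrep x : measurable_fun I (rrep x).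
Proof.
by apply: (measurableT_comp (@fine_measurable R setT _)) => //;
  exact: rep_measurable.
Qed.

Lemma ae_eq_rrep x f : {ae mu, forall t, I t -> rep x t = (f t)%:E} ->
  {ae mu, forall t, I t -> rrep x t = f t}.
Proof. by apply: aeS => t xt It; rewrite /rrep xt. Qed.

Lemma rrep_inj x y : {ae mu, forall t, I t -> rrep x t = rrep y t} -> x = y.
Proof.
move=> xy; apply: rep_inj.
by apply: aeS3 xy (rrepE x) (rrepE y) => t xy xt yt It; rewrite xt // xy // yt.
Qed.

Lemma rrepD x y : {ae mu, forall t, I t -> rrep (x + y) t = rrep x t + rrep y t}.
Proof.
apply: ae_eq_rrep; apply: aeS3 (repD x y) (rrepE x) (rrepE y).
by move=> t xyt xt yt It; rewrite xyt // xt // yt.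
Qed.

Lemma rrepZ c x : {ae mu, forall t, I t -> rrep (c *: x) t = c * rrep x t}.
Proof.
apply: ae_eq_rrep; apply: aeS2 (repZ c x) (rrepE x).
by move=> t cxt xt It; rewrite cxt // xt.
Qed.

Lemma rrep0 : {ae mu, forall t, I t -> rrep (0 : E) t = 0}.
Proof.
rewrite -(scale0r (0 : E)); apply: aeS (rrepZ 0 0) => t + It.
by move=> ->//; rewrite mul0r.
Qed.

Lemma rrepB x y : {ae mu, forall t, I t -> rrep (x - y) t = rrep x t - rrep y t}.
Proof.
rewrite -scaleN1r; apply: aeS2 (rrepD x (-1 *: y)) (rrepZ (-1) y).
by move=> t xyt yt It; rewrite xyt //= yt // mulN1r.
Qed.

Lemma rrep_sum (K : Type) (s : seq K) (u : K -> E) :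
  {ae mu, forall t, I t ->
    rrep (\sum_(k <- s) u k) t = \sum_(k <- s) rrep (u k) t}.
Proof.
elim: s => [|k s IH].
  by rewrite big_nil; apply: aeS rrep0 => t t0 It; rewrite big_nil t0.
rewrite big_cons; apply: aeS2 IH (rrepD (u k) (\sum_(j <- s) u j)).
by move=> t uE sE It; rewrite sE // uE // big_cons.
Qed.

Lemma rrep_ideal f y : measurable_fun I f ->
  {ae mu, forall t, I t -> `|f t| <= `|rrep y t|} ->
  exists x, {ae mu, forall t, I t -> rrep x t = f t} /\ `|x| <= `|y|.
Proof.
move=> mf fy; have [||x [xf xy]] := bfs_ideal (f := EFin \o f) (y := y).
- exact/measurable_EFinP.
- by apply: aeS2 fy (rrepE y) => t ft yt It; rewrite yt //= lee_fin ft.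
- by exists x; split => //; exact: ae_eq_rrep.
Qed.

Lemma le_norm_rrep x y :
  {ae mu, forall t, I t -> `|rrep x t| <= `|rrep y t|} -> `|x| <= `|y|.
Proof.
move=> xy; have [z [zx]] := rrep_ideal _ _ (measurable_rrep x) xy.
by rewrite (rrep_inj _ _ zx).
Qed.

Lemma eq_norm_rrep x y :
  {ae mu, forall t, I t -> `|rrep x t| = `|rrep y t|} -> `|x| = `|y|.
Proof.
by move=> xy; apply/eqP; rewrite eq_le; apply/andP; split; apply: le_norm_rrep;
  apply: aeS xy => t xy It; rewrite xy.
Qed.

Lemma measurable_gt_abs (A : set R) f (l : R) : measurable A ->
  measurable_fun A f -> measurable [set s | A s /\ l < `|f s|].
Proof.
move=> mA mf.
have := measurableT_comp (@normr_measurable R setT) mf.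
move=> /(_ mA `]l, +oo[%classic (measurable_itv _)).
by congr measurable; apply/seteqP; split => t /=; rewrite in_itv/= andbT.
Qed.

Lemma ae_eq_measure (A B : set R) : measurable A -> measurable B ->
  {ae mu, forall t, A t <-> B t} -> mu A = mu B.
Proof.
move=> mA mB [N [mN N0 NAB]]; apply/eqP; rewrite eq_le.
have aux (C D : set R) : measurable C -> measurable D ->
    C `<=` D `|` N -> (mu C <= mu D)%E.
  move=> mC mD CD; rewrite -[leRHS]adde0 -N0.
  apply: (@le_trans _ _ (mu (D `|` N))); last exact: measureU2.
  by apply: le_lebesgue => //; exact: measurableU.
apply/andP; split; apply: aux => // t Ct; have [Nt|Nt] := pselect (N t);
  by [right | left; apply: contrapT => Dt; apply/Nt/NAB => /=; tauto].
Qed.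

Lemma d_rrep y l : d_ I (rep y) l = mu [set s | I s /\ l < `|rrep y s|].
Proof.
apply: ae_eq_measure.
- exact: (emeasurable_fun_o_infty mI
    (measurableT_comp (@abse_measurable R setT) (rep_measurable y)) l%:E).
- exact: measurable_gt_abs (measurable_rrep y).
- apply: aeS (rrepE y) => t yt; split=> -[It].
    by rewrite yt //= lte_fin.
  by move=> lt; split => //; rewrite yt //= lte_fin.
Qed.

Hypothesis hsym : symmetric_space E.

Lemma rrep_equimeasurable f y : measurable_fun I f ->
  (forall l : R, 0 <= l -> mu [set s | I s /\ l < `|f s|] =
                           mu [set s | I s /\ l < `|rrep y s|]) ->
  exists x, {ae mu, forall t, I t -> rrep x t = f t} /\ `|x| = `|y|.
Proof.
move=> mf fy; have [||x [xf xy]] := hsym (EFin \o f) y.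
- exact/measurable_EFinP.
- move=> l l0; rewrite d_rrep -fy // /d_; congr (mu _).
- by exists x; split => //; exact: ae_eq_rrep.
Qed.

Lemma norm_equimeasurable x y :
  (forall l : R, 0 <= l -> mu [set s | I s /\ l < `|rrep x s|] =
                           mu [set s | I s /\ l < `|rrep y s|]) ->
  `|x| = `|y|.
Proof.
move=> xy; have [z [zx <-]] := rrep_equimeasurable _ _ (measurable_rrep x) xy.
by rewrite (rrep_inj _ _ zx).
Qed.

Hypothesis hfatou : fatou_property E.

Lemma rrep_fatou_nondecreasing (u : nat -> E) f (M : R) : measurable_fun I f ->
  (forall n, {ae mu, forall t, I t -> 0 <= rrep (u n) t}) ->
  (forall n, `|u n| <= M) ->
  (forall n, {ae mu, forall t, I t -> rrep (u n) t <= rrep (u n.+1) t}) ->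
  {ae mu, forall t, I t -> rrep (u n) t @[n --> \oo] --> f t} ->
  exists x, [/\ {ae mu, forall t, I t -> rrep x t = f t}, `|x| <= M &
    `|u n| @[n --> \oo] --> `|x|].
Proof.
move=> mf u0 uM ui uf.
have uE : {ae mu, forall t n, I t -> rep (u n) t = (rrep (u n) t)%:E}.
  by apply: ae_foralln => n; exact: rrepE.
have [|||||x [xf _ cx]] := hfatou u (EFin \o f).
- exact/measurable_EFinP.
- by move=> n; apply: aeS2 (u0 n) (rrepE (u n)) => t + + It => + -> //;
    exact.
- by exists M.
- move=> n; apply: aeS2 (ui n) uE => t uit ut It.
  by rewrite !ut // lee_fin uit.
- apply: aeS2 uf uE => t uft ut It.
  rewrite (_ : (fun n => rep (u n) t) = EFin \o (fun n => rrep (u n) t)).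
    by apply: cvg_comp (uft It) _.
  by apply/funext => n /=; rewrite ut.
exists x; split => //; first exact: ae_eq_rrep.
have <- : limn (fun n => `|u n|) = `|x| by exact: cvg_lim.
by apply: limr_le; [apply/cvg_ex; exists (`|x|)|exact: nearW].
Qed.

(** The [v n] represent the infima of [|rrep (u m) t|] over [m >= n]; these increase, so the Fatou
    property applies to them. They are returned along with the limit because order continuity
    squeezes the given sequence between them and the limit. *)
Lemma fatou_minorants (u : nat -> E) f (M : R) : measurable_fun I f ->
  (forall n, `|u n| <= M) ->
  {ae mu, forall t, I t -> `|rrep (u n) t| @[n --> \oo] --> `|f t|} ->
  exists (v : nat -> E) (x : E), [/\
    forall n, {ae mu, forall t, I t -> 0 <= rrep (v n) t <= `|rrep (u n) t|},
    forall n, {ae mu, forall t, I t -> rrep (v n) t <= rrep (v n.+1) t},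
    {ae mu, forall t, I t -> rrep x t = `|f t|},
    `|x| <= M & `|v n| @[n --> \oo] --> `|x|].
Proof.
move=> mf uM uf; pose h n t := infs (fun m => `|rrep (u m) t|) n.
have ub t : has_lbound (range (fun m => `|rrep (u m) t|)).
  by exists 0 => _ [m _ <-].
have mh n : measurable_fun I (h n).
  apply: (@measurable_fun_infs _ _ _ _ (fun m t => `|rrep (u m) t|)) => // m.
  apply: (measurableT_comp (@normr_measurable R setT)).
  exact: measurable_rrep.
have h0 n t : 0 <= h n t.
  apply: lb_le_inf; first by exists `|rrep (u n) t|, n => /=.
  by move=> _ [m _ <-].
have hu n t : h n t <= `|rrep (u n) t|.
  apply: ge_inf; last by exists n => /=.
  by exists 0 => _ [m _ <-].
have hi t : nondecreasing_seq (h ^~ t) by exact: nondecreasing_infs.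
have hf t : `|rrep (u n) t| @[n --> \oo] --> `|f t| ->
    h n t @[n --> \oo] --> `|f t|.
  by move=> c; apply: (@cvg_infs R).
have /choice[v vh] n : exists x, {ae mu, forall t, I t -> rrep x t = h n t} /\
    `|x| <= `|u n|.
  apply: rrep_ideal => //; apply: aeW => t It; rewrite ger0_norm //; exact: hu.
have [|||||x [xf xM cx]] := rrep_fatou_nondecreasing v (fun t => `|f t|) M.
- exact: (measurableT_comp (@normr_measurable R setT)).
- by move=> n; apply: aeS (vh n).1 => t vt It; rewrite vt.
- by move=> n; apply: le_trans (vh n).2 _.
- move=> n; apply: aeS2 (vh n).1 (vh n.+1).1 => t vt vt' It.
  by rewrite vt // vt' //; exact: hi.
- have : {ae mu, forall t n, I t -> rrep (v n) t = h n t}.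
    by apply: ae_foralln => n; exact: (vh n).1.
  move=> vh'; apply: aeS2 uf vh' => t ut vt It.
  rewrite (_ : (fun n => rrep (v n) t) = h ^~ t); first exact/hf/ut.
  by apply/funext => n; exact: vt.
exists v, x; split=> // n.
- by apply: aeS (vh n).1 => t vt It; rewrite vt // h0 hu.
- apply: aeS2 (vh n).1 (vh n.+1).1 => t vt vt' It; rewrite vt // vt' //.
  exact: hi.
Qed.

(** The norm inequality for sums is proved in this form: a ball is solid, convex, invariant under
    equimeasurability and closed under a.e. limits of absolute values, and the sorting argument
    needs nothing else. *)
Definition in_ball (c : R) f :=
  exists x : E, {ae mu, forall t, I t -> rrep x t = f t} /\ `|x| <= c.

Lemma in_ball_solid c f g : measurable_fun I f ->
  {ae mu, forall t, I t -> `|f t| <= `|g t|} -> in_ball c g -> in_ball c f.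
Proof.
move=> mf fg [y [yg yc]]; have [|x [xf xy]] := rrep_ideal f y mf.
  by apply: aeS2 fg yg => t fgt yt It; rewrite yt // fgt.
by exists x; split => //; exact: le_trans yc.
Qed.

Lemma in_ball_convex c f g (a : R) : 0 <= a <= 1 -> in_ball c f ->
  in_ball c g -> in_ball c (fun t => a * f t + (1 - a) * g t).
Proof.
move=> /andP[a0 a1] [x [xf xc]] [y [yg yc]]; exists (a *: x + (1 - a) *: y).
split.
  have xyE : {ae mu, forall t, I t -> rrep (a *: x + (1 - a) *: y) t =
      a * rrep x t + (1 - a) * rrep y t}.
    apply: aeS3 (rrepD (a *: x) ((1 - a) *: y)) (rrepZ a x) (rrepZ (1 - a) y).
    by move=> t xyt xt yt It; rewrite xyt // xt // yt.
  by apply: aeS3 xyE xf yg => t xyt xt yt It; rewrite xyt // xt // yt.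
rewrite (le_trans (ler_normD _ _)) // !normrZ (ger0_norm a0).
by rewrite ger0_norm ?subr_ge0 //; nra.
Qed.

Lemma in_ball_equimeasurable c f g : measurable_fun I f -> measurable_fun I g ->
  (forall l : R, 0 <= l -> mu [set s | I s /\ l < `|f s|] =
                           mu [set s | I s /\ l < `|g s|]) ->
  in_ball c g -> in_ball c f.
Proof.
move=> mf mg fg [y [yg yc]].
have [|x [xf xy]] := rrep_equimeasurable f y mf.
  move=> l l0; rewrite fg //; apply: ae_eq_measure.
  - exact: measurable_gt_abs.
  - exact: measurable_gt_abs (measurable_rrep y).
  - by apply: aeS yg => t yt; split=> /= -[It]; rewrite yt.
by exists x; split => //; rewrite xy.
Qed.

Lemma in_ball_fatou c (f : nat -> R -> R) g : measurable_fun I g ->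
  (forall n, in_ball c (f n)) ->
  {ae mu, forall t, I t -> `|f n t| @[n --> \oo] --> `|g t|} -> in_ball c g.
Proof.
move=> mg fc fg; have /choice[u uf] := fc.
have [|||v [x [_ _ xg xc _]]] := fatou_minorants u g c => //.
- by move=> n; exact: (uf n).2.
- have : {ae mu, forall t n, I t -> rrep (u n) t = f n t}.
    by apply: ae_foralln => n; exact: (uf n).1.
  move=> uf'; apply: aeS2 fg uf' => t ft ut It.
  rewrite (_ : (fun n => `|rrep (u n) t|) = fun n => `|f n t|); first exact/ft.
  by apply/funext => n; rewrite ut.
apply: (in_ball_solid _ _ (fun t => `|g t|)) => //; last by exists x.
by apply: aeW => t _; rewrite normr_id.
Qed.

End real_representatives.

(** * Distribution functions and decreasing rearrangements *)

Section rearrangement.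
Context {R : realType}.
Implicit Types (A : set R) (f : R -> \bar R).

Lemma interval_to_itv (a : \bar R) : (0 <= a)%E ->
  interval_to a = [set` (if a is r%:E then `[0, r[ else `[0, +oo[)%R].
Proof.
case: a => [r| |] // r0; apply/seteqP; split => t /=; rewrite in_itv /=.
- by move=> [-> /=]; rewrite lte_fin.
- by move=> /andP[]; rewrite /interval_to /= lte_fin.
- by move=> [->].
- by rewrite andbT /interval_to /= ltry.
Qed.

Lemma measurable_interval_to (a : \bar R) : (0 <= a)%E ->
  measurable (interval_to a).
Proof. by move=> a0; rewrite interval_to_itv //; case: a a0. Qed.

Lemma measure_interval_to (a : \bar R) : (0 <= a)%E -> mu (interval_to a) = a.
Proof.
move=> a0; rewrite interval_to_itv //.
case: a a0 => [r| |] // r0; rewrite lebesgue_measure_itv /=.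
  rewrite lte_fin; case: ltP => [_|]; first by rewrite oppr0 adde0.
  by rewrite lee_fin in r0 => r0'; congr EFin; apply/le_anti/andP.
by rewrite ltry oppr0 adde0.
Qed.

Lemma d_ge0 A f l : (0 <= d_ A f l)%E. Proof. exact: measure_ge0. Qed.

Lemma measurable_d A f l : measurable A -> measurable_fun A f ->
  measurable [set s | A s /\ (l%:E < `|f s|)%E].
Proof.
move=> mA mf; exact: (emeasurable_fun_o_infty mA
  (measurableT_comp (@abse_measurable R setT) mf) l%:E).
Qed.

Lemma le_d A f l l' : measurable A -> measurable_fun A f -> l <= l' ->
  (d_ A f l' <= d_ A f l)%E.
Proof.
move=> mA mf ll'; apply: le_lebesgue; [exact: measurable_d..|].
move=> s [As ls]; split => //; apply: le_lt_trans ls; by rewrite lee_fin.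
Qed.

Lemma d_le_measure A f l : measurable A -> measurable_fun A f ->
  (d_ A f l <= mu A)%E.
Proof.
by move=> mA mf; apply: le_lebesgue => [|//|s []//]; exact: measurable_d.
Qed.

Lemma d_right_continuous A f l : measurable A -> measurable_fun A f ->
  d_ A f (l + n.+1%:R^-1) @[n --> \oo] --> d_ A f l.
Proof.
move=> mA mf.
rewrite /d_ (_ : [set s | _ /\ (l%:E < _)%E] = \bigcup_n
  [set s | A s /\ ((l + n.+1%:R^-1)%:E < `|f s|)%E]).
  apply: nondecreasing_cvg_mu => [n||].
  - exact: measurable_d.
  - by apply: bigcupT_measurable => n; exact: measurable_d.
  move=> m n mn; apply/subsetPset => s [As ms]; split=> //.
  by apply: le_lt_trans ms; rewrite lee_fin lerD2l lef_pV2 ?posrE // ler_nat.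
apply/seteqP; split=> s.
  move=> [As ls].
  suff [n ns] : exists n : nat, ((l + n.+1%:R^-1)%:E < `|f s|)%E by exists n.
  case: `|f s|%E ls => [r| |] //; last by exists 0%N; rewrite ltry.
  rewrite lte_fin -subr_gt0 => ls.
  have [n _ /(_ n (leqnn n)) /= ns] := near_infty_natSinv_lt (PosNum ls).
  exists n.
  by rewrite lte_fin -ltrBrDl.
move=> [n _ [As ns]]; split=> //; apply: lt_trans ns.
by rewrite lte_fin ltrDl invr_gt0.
Qed.

(** Right continuity of the distribution function turns its generalised inverse into an exact
    equivalence of strict inequalities. Superlevel sets of a rearrangement are thereby initial
    intervals, which is how rearrangements are handled from here on. *)
Lemma lt_rearr A f (t l : R) : measurable A -> measurable_fun A f -> 0 <= l ->
  (l%:E < rearr A f t)%E = (t%:E < d_ A f l)%E.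
Proof.
move=> mA mf l0; apply/idP/idP; last first.
  move=> tl.
  have [n tn] : exists n : nat, (t%:E < d_ A f (l + n.+1%:R^-1))%E.
    have := d_right_continuous A f l mA mf.
    move=> /(_ _ (open_nbhs_nbhs (conj (@open_ereal_gt_ereal R t%:E) tl))).
    by move=> [n _ /(_ n (leqnn n)) /= ?]; exists n.
  apply: (@lt_le_trans _ _ (l + n.+1%:R^-1)%:E).
    by rewrite lte_fin ltrDl invr_gt0.
  apply: le_ereal_inf_tmp => _ [k [k0 kt] <-]; rewrite lee_fin leNgt.
  apply/negP => kn; move: tn; apply/negP; rewrite -leNgt.
  by apply: le_trans kt; apply: le_d => //; exact: ltW.
apply: contraTT; rewrite -!leNgt => dt; apply/lee_addgt0Pr => e e0.
apply: ereal_inf_lbound; exists (l + e) => //; split; first exact: ltr_wpDl.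
by apply: le_trans dt; apply: le_d => //; rewrite lerDl ltW.
Qed.

Lemma rearr_ge0 A f t : (0 <= rearr A f t)%E.
Proof.
by apply: le_ereal_inf_tmp => _ [k [k0 _] <-]; rewrite lee_fin ltW.
Qed.

Lemma measurable_lt (c : \bar R) : measurable [set t : R | (t%:E < c)%E].
Proof.
case: c => [r| |].
- by rewrite (_ : [set _ | _] = `]-oo, r[%classic) //.
- rewrite (_ : [set _ | _] = setT) //.
  by apply/seteqP; split=> t //= _; rewrite ltry.
- by rewrite (_ : [set _ | _] = set0) //; apply/seteqP; split.
Qed.

Lemma measurable_rearr A f : measurable A -> measurable_fun A f ->
  measurable_fun setT (rearr A f).
Proof.
move=> mA mf; apply: (measurability _ (ErealGenOInfty.measurableE R)) => //.
move=> _ [_ [r ->] <-]; rewrite setTI.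
have [r0|r0] := leP 0 r; last first.
  rewrite (_ : _ @^-1` _ = setT) //; apply/seteqP; split => t //= _.
  rewrite in_itv /= andbT; apply: lt_le_trans (rearr_ge0 _ _ _).
  by rewrite lte_fin.
rewrite (_ : _ @^-1` _ = [set t : R | (t%:E < d_ A f r)%E]).
  exact: measurable_lt.
by apply/seteqP; split=> t /=; rewrite in_itv /= andbT lt_rearr.
Qed.

Lemma d_rearr (a : \bar R) f l : (0 <= a)%E ->
  measurable_fun (interval_to a) f -> 0 <= l ->
  d_ (interval_to a) (rearr (interval_to a) f) l = d_ (interval_to a) f l.
Proof.
move=> a0 mf l0; have mI := measurable_interval_to a a0.
rewrite -[RHS]measure_interval_to ?d_ge0 // {1}/d_.
congr (mu _); apply/seteqP; split=> t /=.
  by move=> [[t0 ta]]; rewrite gee0_abs ?rearr_ge0 // lt_rearr.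
move=> [t0 td]; rewrite gee0_abs ?rearr_ge0 // lt_rearr //; split=> //.
split=> //; apply: lt_le_trans td _.
by rewrite -[leRHS]measure_interval_to //; exact: d_le_measure.
Qed.

(* The intermediate value theorem for [r |-> mu (A `&` `]-oo, r])]. *)
Lemma initial_segment A (c : R) : measurable A -> A `<=` [set t | 0 <= t] ->
  0 <= c -> (c%:E <= mu A)%E ->
  exists S : set R, [/\ measurable S, forall s t, S t -> s <= t -> S s &
    mu (A `&` S) = c%:E].
Proof.
move=> mA A0 c0; rewrite le_eqVlt => /orP[/eqP cA|cA].
  (* The full measure may be reached only in the limit, so it gets the whole line instead of a
     half-line. *)
  by exists setT; split; rewrite ?setIT.
pose S (r : R) : set R := `]-oo, r]%classic.
have mAS r : measurable (A `&` S r).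
  by apply: measurableI => //; exact: measurable_itv.
(* The measure grows by at most the length of ]r, s], so that [F] below is 1-Lipschitz and hence
   continuous. *)
have AS r s : r <= s -> (mu (A `&` S s) <= mu (A `&` S r) + (s - r)%:E)%E.
  move=> rs; have -> : (s - r)%:E = mu (`]r, s]%classic : set R).
    rewrite lebesgue_measure_itv /= lte_fin.
    by case: ltgtP rs => // -> _; rewrite subrr.
  apply: (@le_trans _ _ (mu ((A `&` S r) `|` `]r, s]%classic))).
    apply: le_lebesgue => //; first exact: measurableU.
    move=> t [At]; rewrite /S /= !in_itv /= => ts.
    by case: (leP t r) => tr; [left; split; rewrite //= in_itv|right].
  by apply: measureU2; [exact: mAS|exact: measurable_itv].
have AS0 : mu (A `&` S 0) = 0.
  apply/eqP; rewrite eq_le measure_ge0 andbT.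
  rewrite -(lebesgue_measure_set1 (0 : R)).
  apply: le_lebesgue => // t [/A0 /= t0]; rewrite /S /= in_itv /= => t0'.
  by apply/le_anti/andP.
have ASle r s : r <= s -> (mu (A `&` S r) <= mu (A `&` S s))%E.
  move=> rs; apply: le_lebesgue => // t [At]; rewrite /S /= !in_itv /= => tr.
  by split => //; exact: le_trans rs.
have finAS r : mu (A `&` S r) \is a fin_num.
  rewrite ge0_fin_numE //; have [r0|r0] := leP 0 r.
    by apply: le_lt_trans (AS _ _ r0) _; rewrite AS0 add0e ltry.
  by apply: le_lt_trans (ASle _ _ (ltW r0)) _; rewrite AS0.
pose F r := fine (mu (A `&` S r)).
have FE r : mu (A `&` S r) = (F r)%:E by rewrite /F fineK.
have Flip r s : `|F r - F s| <= `|r - s|.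
  wlog rs : r s / r <= s.
    move=> wl; case: (leP r s) => [/wl //|/ltW/wl].
    by rewrite distrC (distrC s).
  rewrite distrC (distrC r) !ger0_norm ?subr_ge0 //; last first.
    by rewrite -lee_fin -!FE ASle.
  by rewrite lerBlDl -lee_fin EFinD -!FE AS.
have Fc : continuous F.
  move=> r; apply/cvgrPdist_lt => e e0; near=> s.
  apply: le_lt_trans (Flip _ _) _; near: s.
  by exists e.
have [n cn] : exists n : nat, (c%:E < mu (A `&` S n%:R))%E.
  have : mu (A `&` S n%:R) @[n --> \oo] --> mu A.
    rewrite {2}(_ : A = \bigcup_n (A `&` S n%:R)).
      apply: nondecreasing_cvg_mu => [n||].
      - exact: mAS.
      - by apply: bigcupT_measurable => n; exact: mAS.
      move=> m n mn; apply/subsetPset => t [At]; rewrite /S /= !in_itv /= => tm.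
      by split => //; rewrite (le_trans tm) // ler_nat.
    rewrite -setI_bigcupr; apply/seteqP; split=> [t At|t []//].
    split=> //.
    by exists (Num.bound t) => //; rewrite /S /= in_itv /= ltW // archi_boundP // A0.
  move=> /(_ _ (open_nbhs_nbhs (conj (@open_ereal_gt_ereal R c%:E) cA))).
  by move=> [n _ /(_ n (leqnn n)) /= ?]; exists n.
have [||r _ Fr] := @IVT R F 0 n%:R c (ler0n _ _).
- exact: continuous_subspaceT.
- have F0 : F 0 = 0 by rewrite /F AS0.
  rewrite ge_min le_max F0 c0 /=; apply/orP; right.
  by rewrite -lee_fin -FE ltW.
exists (S r); split; [exact: measurable_itv| |by rewrite FE Fr].
move=> s t; rewrite /S /= !in_itv /= => tr st; exact: le_trans tr.
Unshelve. all: by end_near. Qed.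

End rearrangement.

(** * Ryff's theorem *)

Section ryff.
Context {R : realType}.
Implicit Types (A : set R) (u : R -> R).

Lemma measurable_ge A u l : measurable A -> measurable_fun A u ->
  measurable [set s | A s /\ l <= u s].
Proof.
move=> mA mu'; have := mu' mA `[l, +oo[%classic (measurable_itv _).
by congr measurable; apply/seteqP; split => t /=; rewrite in_itv/= andbT.
Qed.

(** Continuity of the measure from above. The levels start at [l / 2], which is positive, so already
    the first set has finite measure. *)
Lemma d_left_limit A u l : measurable A -> measurable_fun A u ->
  (forall s, 0 <= u s) -> 0 < l ->
  (forall l', 0 < l' -> (d_ A (EFin \o u) l' < +oo)%E) ->
  d_ A (EFin \o u) (l - l / n.+2%:R) @[n --> \oo] -->
    mu [set s | A s /\ l <= u s].
Proof.
move=> mA mu' u0 l0 dfin; have mEu : measurable_fun A (EFin \o u).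
  exact/measurable_EFinP.
have ln n : l - l / n.+2%:R < l by rewrite ltrBlDr ltrDl divr_gt0.
have ln0 n : 0 < l - l / n.+2%:R.
  by rewrite subr_gt0 ltr_pdivrMr // ltr_pMr // ltr1n.
rewrite (_ : [set s | A s /\ l <= u s] = \bigcap_n
  [set s | A s /\ ((l - l / n.+2%:R)%:E < `|(EFin \o u) s|)%E]).
  apply: nonincreasing_cvg_mu => [|n||].
  - exact: dfin.
  - exact: measurable_d.
  - by apply: bigcapT_measurable => n; exact: measurable_d.
  move=> m n mn; apply/subsetPset => s [As ms]; split=> //.
  apply: le_lt_trans ms; rewrite lee_fin lerD2l lerN2.
  by rewrite ler_pM2l // lef_pV2 ?posrE // ler_nat.
apply/seteqP; split=> s /=.
  by move=> [As ls] n _; split=> //=; rewrite ger0_norm // lte_fin (lt_le_trans (ln n)).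
move=> H; split; first by have [] := H 0%N I.
rewrite leNgt; apply/negP => ul.
have lu : 0 < (l - u s) / l by rewrite divr_gt0 // subr_gt0.
have [n _ /(_ n (leqnn n)) /= ns] := near_infty_natSinv_lt (PosNum lu).
have [_] := H n I; rewrite /= ger0_norm // lte_fin; apply/negP; rewrite -leNgt.
rewrite lerBrDr -lerBrDl.
have : n.+2%:R^-1 <= (l - u s) / l.
  by apply: le_trans (ltW ns); rewrite lef_pV2 ?posrE // ler_nat.
by rewrite ler_pdivlMr // mulrC.
Qed.

Variables (alpha : \bar R) (u : R -> R).
Hypothesis alpha0 : (0 < alpha)%E.
Local Notation I := (interval_to alpha).
Hypothesis mu' : measurable_fun I u.
Hypothesis u0 : forall s, 0 <= u s.
Hypothesis dfin : forall l, 0 < l -> (d_ I (EFin \o u) l < +oo)%E.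

Let mI : measurable I. Proof. by apply: measurable_interval_to; exact: ltW. Qed.
Let mEu : measurable_fun I (EFin \o u). Proof. exact/measurable_EFinP. Qed.

Lemma d_cvg0 : d_ I (EFin \o u) n.+1%:R @[n --> \oo] --> (0 : \bar R).
Proof.
rewrite -(measure0 (@lebesgue_measure R)).
rewrite (_ : set0 = \bigcap_n
  [set s | I s /\ (n.+1%:R%:E < `|(EFin \o u) s|)%E]).
  apply: nonincreasing_cvg_mu => [|n||].
  - exact: dfin.
  - exact: measurable_d.
  - by apply: bigcapT_measurable => n; exact: measurable_d.
  move=> m n mn; apply/subsetPset => s [As ms]; split=> //.
  by apply: le_lt_trans ms; rewrite lee_fin ler_nat.
apply/esym; rewrite -subset0 => s /(_ (Num.bound (u s)) Logic.I) [_] /=.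
rewrite ger0_norm // lte_fin => H.
by have := archi_boundP (u0 s); rewrite ltNge (le_trans _ (ltW H)) // ler_nat.
Qed.

Lemma rearr_fin_num t : 0 < t -> rearr I (EFin \o u) t \is a fin_num.
Proof.
move=> t0; rewrite ge0_fin_numE ?rearr_ge0 //.
have t0E : (0 < t%:E)%E by rewrite lte_fin.
have [n dn] : exists n : nat, (d_ I (EFin \o u) n.+1%:R < t%:E)%E.
  have := d_cvg0 _ (open_nbhs_nbhs (conj (@open_ereal_lt_ereal R t%:E) t0E)).
  by move=> [n _ /(_ n (leqnn n)) /= ?]; exists n.
apply: (@le_lt_trans _ _ n.+1%:R%:E); last exact: ltry.
by rewrite leNgt lt_rearr // -leNgt ltW.
Qed.

(* [s'] precedes [s] if [u s' > u s], or if [u s' = u s] and [s' <= s]. *)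
Lemma ryff_slice q : 0 < q -> (q%:E < alpha)%E -> exists D : set R,
  [/\ measurable D, D `<=` I, mu D = q%:E,
    forall s s', D s -> I s' -> u s < u s' \/ u s = u s' /\ s' <= s -> D s' &
    forall l, 0 <= l -> (q%:E < d_ I (EFin \o u) l)%E ->
      forall s, D s -> l < u s].
Proof.
move=> q0 qa.
(* At this level the set [H] where [u > l] has measure at most [q], and together with the set [A]
   where [u = l] it has measure at least [q]. The slice consists of [H] and an initial segment of
   [A] that supplies the missing measure. *)
pose l := fine (rearr I (EFin \o u) q).
have lE : rearr I (EFin \o u) q = l%:E by rewrite /l fineK ?rearr_fin_num.
have l0 : 0 <= l by rewrite -lee_fin -lE rearr_ge0.
have dl : (d_ I (EFin \o u) l <= q%:E)%E by rewrite leNgt -lt_rearr // lE ltxx.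
have dlfin : d_ I (EFin \o u) l \is a fin_num.
  by rewrite ge0_fin_numE ?d_ge0 // (le_lt_trans dl) // ltry.
pose A := [set s | I s /\ u s = l].
have mA : measurable A.
  have := mu' mI [set l] (measurable_set1 l).
  by congr measurable.
pose H := [set s | I s /\ (l%:E < `|(EFin \o u) s|)%E].
have HE s : H s <-> I s /\ l < u s by rewrite /H /= ger0_norm.
have mH : measurable H by exact: measurable_d.
have HA : (q%:E <= mu (H `|` A))%E.
  have -> : H `|` A = [set s | I s /\ l <= u s].
    apply/seteqP; split=> s.
      by move=> [/HE[Is /ltW ls]|[Is us]]; split=> //; rewrite us.
    move=> [Is]; rewrite le_eqVlt => /orP[/eqP ls|ls]; first by right; split.
    by left; apply/HE.
  (* For [l = 0] the set is all of [I]. For [l > 0] each lower level is exceeded on a set of measure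
     more than [q], and the measure in question is the limit of these. *)
  have [l0'|l0'] := eqVneq l 0.
    rewrite (_ : [set s | _] = I).
      by rewrite measure_interval_to ?ltW // ltW.
    by apply/seteqP; split=> [s []|s Is] //; split=> //; rewrite l0'.
  have lp : 0 < l by rewrite lt_neqAle eq_sym l0'.
  have /cvg_lim <- // := d_left_limit I u l mI mu' u0 lp dfin.
  apply: lime_ge.
    by apply/cvg_ex; eexists; exact: (d_left_limit I u l mI mu' u0 lp dfin).
  apply: nearW => n; apply/ltW; rewrite -lt_rearr //.
    by rewrite lE lte_fin ltrBlDr ltrDl divr_gt0.
  by rewrite subr_ge0 ler_pdivrMr // ler_peMr // ler1n.
have HA0 : H `&` A = set0.
  by rewrite -subset0 => s [/HE[_ ls] [_ us]]; rewrite us ltxx in ls.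
have [|||S [mS Sdown AS]] := initial_segment A (q - fine (mu H)) mA.
- by move=> s [[]].
- by rewrite subr_ge0 -lee_fin fineK.
- rewrite EFinB fineK // leeBlDl //.
  by rewrite -measureU.
exists (H `|` (A `&` S)); split.
- by apply: measurableU => //; exact: measurableI.
- by move=> s [/HE[]|[[]]].
- rewrite lebesgueU //; [|exact: measurableI|by rewrite setIA HA0 set0I].
  have := fineK dlfin; rewrite /d_ -/H => <-.
  by rewrite AS -EFinD subrKC.
- move=> s s' Ds Is' [us|[us s's]].
    left; apply/HE; split=> //; apply: le_lt_trans us.
    by case: Ds => [/HE[_ /ltW]|[[_ ->]]].
  case: Ds => [/HE[Is ls]|[[Is us'] Ss]]; first by left; apply/HE; rewrite -us.
  by right; split; [split=> //; rewrite -us|exact: Sdown s's].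
- move=> l' l'0; rewrite -lt_rearr // lE lte_fin => l'l s Ds.
  by apply: lt_le_trans l'l _; case: Ds => [/HE[_ /ltW]|[[_ ->]]].
Qed.

(** Order the points by decreasing [u], ties by position; [sigma s] is the measure of what precedes
    [s], obtained as the infimum of the [q] whose slice contains [s]. If [u > 0] on a set of
    infinite measure, the zeros of [u] belong to no slice, which is why [V] can be smaller than
    [I]. *)
Lemma ryff : exists (V : set R) (sigma : R -> R), [/\
  measurable V /\ V `<=` I, measurable_fun setT sigma /\
    (forall s, V s -> I (sigma s)),
  forall B, measurable B -> mu (sigma @^-1` B `&` V) = mu (B `&` I),
  {ae mu, forall s, V s -> rearr I (EFin \o u) (sigma s) = (u s)%:E} &
  {ae mu, forall s, I s -> ~ V s -> u s = 0}].
Proof.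
have /choice[D DP] q : exists D : set R, 0 < q -> (q%:E < alpha)%E ->
  [/\ measurable D, D `<=` I, mu D = q%:E,
    forall s s', D s -> I s' -> u s < u s' \/ u s = u s' /\ s' <= s -> D s' &
    forall l, 0 <= l -> (q%:E < d_ I (EFin \o u) l)%E ->
      forall s, D s -> l < u s].
  have [[q0 qa]|qN] := pselect (0 < q /\ (q%:E < alpha)%E).
    by have [D DP] := ryff_slice q q0 qa; exists D.
  by exists set0 => q0 qa; case: qN.
(* Slices are initial segments of one total order. If a point of [D q] were missing from [D q'], all
   of [D q'] would precede it and so lie in [D q], against the measures. *)
have Dmono q q' : 0 < q -> q < q' -> (q'%:E < alpha)%E -> D q `<=` D q'.
  move=> q0 qq' q'a s Ds; apply: contrapT => D's.
  have qa : (q%:E < alpha)%E by apply: lt_trans q'a; rewrite lte_fin.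
  have [mD DI muD down _] := DP _ q0 qa.
  have [mD' DI' muD' down' _] := DP _ (lt_trans q0 qq') q'a.
  suff D'D : D q' `<=` D q.
    have := le_lebesgue _ _ mD' mD D'D.
    by rewrite muD muD' lee_fin leNgt qq'.
  move=> s' Ds'; apply: down (Ds) (DI' _ Ds') _.
  apply: contrapT => /not_orP[/negP]; rewrite -leNgt => us nus.
  apply: D's; apply: down' (Ds') (DI _ Ds) _.
  move: us; rewrite le_eqVlt => /orP[/eqP us|]; last by left.
  right; split=> //; rewrite leNgt; apply/negP => ss; apply: nus.
  by split; rewrite ?us // ltW.
(* Only slices with [q < t] enter, because an infimum need not be attained: this is exactly the part
   of [V] where [sigma < t]. As an increasing union it still has measure [t], as long as
   [t <= alpha]. *)
pose G t := [set s | exists q, [/\ 0 < q, q < t, (q%:E < alpha)%E & D q s]].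
pose V := [set s | exists q, [/\ 0 < q, (q%:E < alpha)%E & D q s]].
have muG t : 0 < t -> (t%:E <= alpha)%E -> measurable (G t) /\ mu (G t) = t%:E.
  move=> t0 ta; pose q n : R := t - t / n.+2%:R.
  have qt n : q n < t by rewrite ltrBlDr ltrDl divr_gt0.
  have q0 n : 0 < q n by rewrite subr_gt0 ltr_pdivrMr // ltr_pMr // ltr1n.
  have qa n : ((q n)%:E < alpha)%E by apply: lt_le_trans ta; rewrite lte_fin.
  have GE : G t = \bigcup_n D (q n).
    apply/seteqP; split=> s; last by move=> [n _ Ds]; exists (q n).
    move=> [r [r0 rt ra Dr]].
    have tr : 0 < (t - r) / t by rewrite divr_gt0 // subr_gt0.
    have [n _ /(_ n (leqnn n)) /= nt] := near_infty_natSinv_lt (PosNum tr).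
    exists n => //; apply: Dmono Dr => //.
    have : n.+2%:R^-1 < (t - r) / t.
      by apply: le_lt_trans nt; rewrite lef_pV2 ?posrE // ler_nat.
    by rewrite ltr_pdivlMr // mulrC /q ltrBrDr -ltrBrDl.
  have mG : measurable (G t).
    rewrite GE; apply: bigcupT_measurable => n.
    by have [] := DP _ (q0 n) (qa n).
  split=> //.
  have : mu (D (q n)) @[n --> \oo] --> mu (G t).
    rewrite GE; apply: nondecreasing_cvg_mu => [n||].
    - by have [] := DP _ (q0 n) (qa n).
    - by rewrite -GE.
    - move=> m n mn; apply/subsetPset.
      have : q m <= q n.
        by rewrite lerD2l lerN2 ler_pM2l // lef_pV2 ?posrE // ler_nat.
      rewrite le_eqVlt => /orP[/eqP -> //|qmn]; exact: Dmono.
  have -> : (fun n => mu (D (q n))) = (fun n => (q n)%:E).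
    by apply/funext => n; have [] := DP _ (q0 n) (qa n).
  move=> /cvg_lim <- //; apply/cvg_lim => //; apply: cvg_EFin.
    exact: nearW.
  rewrite (_ : fine \o _ = q); last exact/funext.
  rewrite -[X in _ --> X]subr0; apply: cvgB; first exact: cvg_cst.
  rewrite -[X in _ --> X](mulr0 t); apply: cvgM; first exact: cvg_cst.
  have := @cvg_harmonic R; rewrite -(@cvg_shiftS _ (@harmonic R)).
  by [].
have GV t : (alpha <= t%:E)%E -> G t = V.
  move=> at_; apply/seteqP; split=> s; first by move=> [q [q0 _ qa Dq]]; exists q.
  move=> [q [q0 qa Dq]]; exists q; split=> //.
  by rewrite -lte_fin; exact: lt_le_trans at_.
pose sigma s := if s \in V then
  inf [set q | [/\ 0 < q, (q%:E < alpha)%E & D q s]] else -1.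
have Gsigma t : [set s | V s /\ sigma s < t] = G t.
  apply/seteqP; split=> s.
    move=> [Vs]; rewrite /sigma mem_set // => /inf_lt[//|q [q0 qa Dq] qt].
    by exists q.
  move=> [q [q0 qt qa Dq]]; have Vs : V s by exists q.
  split=> //; rewrite /sigma mem_set //; apply: le_lt_trans qt.
  by apply: ge_inf => //; exists 0 => r [/ltW].
have sigma0 s : V s -> 0 <= sigma s.
  by move=> Vs; rewrite /sigma mem_set //; apply: lb_le_inf => // q [/ltW].
have VI : V `<=` I.
  by move=> s [q [q0 qa Ds]]; have [_ DI _ _ _] := DP _ q0 qa; exact: DI.
have sigmaI s : V s -> I (sigma s).
  move=> Vs; split; first exact: sigma0.
  have [q [q0 qa Dq]] := (Vs); apply: le_lt_trans (qa); rewrite lee_fin.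
  rewrite /sigma mem_set //; apply: ge_inf; last by split.
  by exists 0 => r [/ltW].
have IE t0 : (t0%:E <= alpha)%E ->
    `]-oo, t0[%classic `&` I = interval_to t0%:E.
  move=> ta; apply/seteqP; split=> s /=; rewrite in_itv /= /interval_to /=.
    by move=> [st []].
  by rewrite lte_fin => -[s0 st]; do 2!split=> //; apply: lt_le_trans ta.
have GP t : measurable (G t) /\ mu (G t) = mu (`]-oo, t[%classic `&` I).
  have [t0|t0] := leP t 0.
    rewrite (_ : G t = set0); last first.
      rewrite -subset0 => s [q [q0 qt _ _]].
      by have := lt_trans q0 qt; rewrite ltNge t0.
    rewrite (_ : _ `&` I = set0) // -subset0 => s [/=]; rewrite in_itv /= => st.
    by move=> [s0 _]; have := le_lt_trans s0 st; rewrite ltNge t0.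
  have [ta|at_] := leP t%:E alpha.
    have [mG ->] := muG t t0 ta.
    by split=> //; rewrite IE // measure_interval_to // lee_fin ltW.
  case aE : alpha alpha0 at_ => [a| |] // a0; rewrite lte_fin => at_.
  have [|mG muGa] := muG a a0; first by rewrite aE.
  rewrite GV ?aE ?lee_fin ?ltW // -(GV a) ?aE //; split=> //.
  rewrite muGa (_ : _ `&` _ = interval_to a%:E).
    by rewrite measure_interval_to // ltW.
  rewrite setIidr // => s [s0]; rewrite /= lte_fin in_itv /= => sa.
  exact: lt_trans at_.
have mV : measurable V.
  rewrite (_ : V = \bigcup_n G n%:R).
    by apply: bigcupT_measurable => n; have [] := GP n%:R.
  apply/seteqP; split=> s; last by move=> [n _ [q [q0 _ qa Dq]]]; exists q.
  move=> [q [q0 qa Dq]]; exists (Num.bound q) => //; exists q; split=> //.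
  exact/archi_boundP/ltW.
have msigma : measurable_fun setT sigma.
  apply: (measurability _ (RGenInftyO.measurableE R)) => //.
  move=> _ [_ [t ->] <-]; rewrite setTI.
  rewrite (_ : _ @^-1` _ = G t `|` [set s | ~ V s /\ -1 < t]).
    apply: measurableU; first by have [] := GP t.
    have [t1|t1] := ltP (-1) t.
      rewrite (_ : [set s | _] = ~` V); first exact: measurableC.
      by apply/seteqP; split => s // [].
    by rewrite (_ : [set s | _] = set0) // -subset0 => s [].
  rewrite -Gsigma; apply/seteqP; split=> s /=; rewrite in_itv /=.
    have [Vs st|Vs] := pselect (V s); first by left.
    by rewrite /sigma memNset // => t1; right.
  by move=> [[]//|[Vs t1]]; rewrite /sigma memNset.
have push B : measurable B -> mu (sigma @^-1` B `&` V) = mu (B `&` I).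
  move=> mB.
  pose m1 : {measure set (measurableTypeR R) -> \bar R} :=
    @measure_function_pushforward__canonical__measure_function_Measure _ _
      (measurableTypeR R) (measurableTypeR R) R (mrestr mu mV) sigma msigma.
  pose m2 : {measure set (measurableTypeR R) -> \bar R} := mrestr mu mI.
  (* Half-lines ]-oo, t[ are stable under intersection and exhaust the line, and both measures are
     finite and equal on them. *)
  suff : m1 B = m2 B by [].
  refine (@measure_unique _ R (measurableTypeR R) (@RGenInftyO.G R)
    (fun n => `]-oo, n%:R[%classic) _ _ _ _ m1 m2 _ _ B mB) => //.
  - exact: RGenInftyO.measurableE.
  - move=> _ _ [s ->] [t ->]; exists (Num.min s t).
    by apply/seteqP; split=> r /=; rewrite !in_itv /= lt_min => /andP.
  - by move=> n; exists n%:R.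
  - apply/seteqP; split=> // s _; exists (Num.bound `|s|) => //=.
    rewrite in_itv /=; apply: le_lt_trans (ler_norm _) _.
    by have := archi_boundP (normr_ge0 s).
  - move=> _ [t ->]; rewrite /= /pushforward /mrestr.
    have [_ <-] := GP t; rewrite -Gsigma; congr (mu _).
    by apply/seteqP; split=> s /=; rewrite in_itv /= => -[].
  - move=> n; rewrite /= /pushforward /mrestr.
    apply: (@le_lt_trans _ _ (mu (G n%:R))).
      rewrite -Gsigma; apply: le_lebesgue.
      + apply: measurableI => //.
        have := msigma measurableT _ (measurable_itv `]-oo, n%:R[%R).
        by rewrite setTI.
      + by rewrite Gsigma; have [] := GP n%:R.
      + by move=> s [/=]; rewrite in_itv /=.
    have [_ ->] := GP n%:R.
    apply: (@le_lt_trans _ _ (mu (interval_to n%:R%:E))); last first.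
      by rewrite measure_interval_to ?ltry // lee_fin.
    apply: le_lebesgue.
    + exact: measurableI.
    + by apply: measurable_interval_to; rewrite lee_fin.
    + by move=> s [/=]; rewrite in_itv /= => sn [s0 _]; split.
pose d l := d_ I (EFin \o u) l.
have dE l : 0 < l -> d l = (fine (d l))%:E.
  by move=> l0; rewrite fineK // ge0_fin_numE ?dfin // d_ge0.
(* The set where [sigma < d l] is contained in the set where [u > l], and both have the finite
   measure [d l], so they differ by a null set. *)
have aeG l : 0 < l -> {ae mu, forall s, I s ->
    l < u s <-> V s /\ ((sigma s)%:E < d l)%E}.
  move=> l0; pose H := [set s | I s /\ (l%:E < `|(EFin \o u) s|)%E].
  have mH : measurable H by exact: measurable_d.
  have [mG muGd] := GP (fine (d l)).
  have GH : G (fine (d l)) `<=` H.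
    move=> s [q [q0 qd qa Dq]]; have [_ DI _ _ Dl] := DP _ q0 qa.
    split; first exact: DI.
    rewrite /= ger0_norm // lte_fin; apply: Dl Dq; first exact: ltW.
    by rewrite -/(d l) dE.
  have muGH : mu (H `\` G (fine (d l))) = 0.
    rewrite lebesgueD //; last exact: dfin.
    rewrite muGd IE; last first.
      rewrite -dE // -[leRHS]measure_interval_to; last exact: ltW.
      exact: d_le_measure.
    rewrite measure_interval_to ?lee_fin ?fine_ge0 ?d_ge0 //.
    rewrite [X in (X - _)%E](_ : _ = d l) // dE // subee //.
  exists (H `\` G (fine (d l))); split=> //; first exact: measurableD.
  move=> s /=; rewrite dE // => /not_implyP[Is nus].
  rewrite -Gsigma /=; rewrite lte_fin in nus.
  have [us|us] := ltP l (u s).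
    by split=> [|Gs]; [rewrite /H /= ger0_norm|apply: nus].
  exfalso; apply: nus; split=> [|Gs]; first by rewrite ltNge us.
  have : G (fine (d l)) s by rewrite -Gsigma.
  by move=> /GH [_]; rewrite /= ger0_norm // lte_fin.
(* Rational levels need only one null set for all of them, and they suffice to compare two
   values. *)
have aeGr : {ae mu, forall s, forall r : rat, 0 < (ratr r : R) -> I s ->
    ratr r < u s <-> V s /\ ((sigma s)%:E < d (ratr r))%E}.
  apply: ae_forall_count => r; have [r0|r0] := ltP 0 (ratr r : R); last first.
    by apply: aeW.
  have aux := aeG (ratr r) r0.
  by apply: aeS aux => s H _; exact: H.
have {}aeGr : {ae mu, forall s, I s -> forall r : rat, 0 < (ratr r : R) ->
    ratr r < u s <-> V s /\ ((sigma s)%:E < d (ratr r))%E}.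
  by apply: aeS aeGr => s H Is r r0; apply: H.
exists V, sigma; split => //.
  apply: aeS aeGr => s H Vs; have Is := VI _ Vs.
  have Hr (r : rat) : 0 < (ratr r : R) ->
      ((ratr r)%:E < rearr I (EFin \o u) (sigma s))%E = (ratr r < u s).
    move=> r0; rewrite lt_rearr //; last exact: ltW.
    by apply/idP/idP => [rs|/(H Is r r0)[]//]; apply/H.
  have rat_between (a : R) (b : \bar R) : (a%:E < b)%E ->
      exists r : rat, a < ratr r /\ ((ratr r)%:E < b)%E.
    case: b => [b| |] // ab.
      by have [r] := rat_in_itvoo ab; rewrite in_itv /= => /andP[]; exists r.
    have a1 : a < a + 1 by rewrite ltrDl.
    have [r] := rat_in_itvoo a1; rewrite in_itv /= => /andP[ar _].
    by exists r; rewrite ltry.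
  apply/eqP; rewrite eq_le; apply/andP; split.
    rewrite leNgt; apply/negP => /rat_between[r [ur rr]].
    have r0 : 0 < (ratr r : R) by apply: le_lt_trans ur.
    by rewrite Hr // ltNge (ltW ur) in rr.
  rewrite leNgt; apply/negP.
  case rE : (rearr _ _ _) => [b| |]; last 2 first.
  - by rewrite ltNge leey.
  - by have := rearr_ge0 I (EFin \o u) (sigma s); rewrite rE.
  rewrite lte_fin => bu; have [r] := rat_in_itvoo bu.
  rewrite in_itv /= => /andP[br ru].
  have b0 : 0 <= b by rewrite -lee_fin -rE rearr_ge0.
  have := Hr r (le_lt_trans b0 br); rewrite ru rE lte_fin => rb.
  by have := lt_trans br rb; rewrite ltxx.
apply: aeS aeGr => s H Is Vs; apply/eqP; rewrite eq_le u0 andbT leNgt.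
apply/negP => us; have [r] := rat_in_itvoo us.
by rewrite in_itv /= => /andP[r0 ru]; have [/(_ ru)[]] := H Is r r0.
Qed.

End ryff.

(** * Splitting into cells of equal measure *)

Section levels.
Context {R : realType}.
Implicit Types (delta y : R) (N j : nat).

(** The strict inequality makes the points of level at least [j > 0] a strict superlevel set, as
    measured by [d_]. The empty maximum gives level 0 to values [y <= 0] too. *)
Definition lev delta N y : nat := \max_(j < N.+1 | j%:R * delta < y) j.

Lemma lev_le delta N y : (lev delta N y <= N)%N.
Proof. by apply/bigmax_leqP => j _; rewrite -ltnS. Qed.

Lemma leq_lev delta N y j : 0 < delta -> (j <= N)%N ->
  (j <= lev delta N y)%N = (j == 0)%N || (j%:R * delta < y).
Proof.
move=> d0 jN; apply/idP/idP; last first.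
  case/orP => [/eqP -> //|jy].
  rewrite -[leqLHS](@inordK N j) //.
  by apply: leq_bigmax_cond; rewrite inordK.
have [->|[i iy ->] ji] : lev delta N y = 0%N \/
    exists2 i : nat, i%:R * delta < y & lev delta N y = i.
- rewrite /lev; elim/big_ind: _ => [|a b Ha Hb|i iy]; first by left.
    by rewrite /maxn; case: ifP.
  by right; exists i.
- by rewrite leqn0 => ->.
- by rewrite orbC (le_lt_trans _ iy) // ler_wpM2r ?ler_nat // ltW.
Qed.

Lemma lev_lb delta N y : 0 < delta -> 0 <= y -> (lev delta N y)%:R * delta <= y.
Proof.
move=> d0 y0; have := leq_lev delta N y (lev delta N y) d0 (lev_le _ _ _).
by rewrite leqnn => /esym/orP[/eqP ->|/ltW//]; rewrite mul0r.
Qed.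

Lemma lev_ub delta N y : 0 < delta -> y <= N%:R * delta ->
  y <= (lev delta N y).+1%:R * delta.
Proof.
move=> d0 yN; have [lN|Nl] := ltnP (lev delta N y) N.
  by have := leq_lev delta N y _ d0 lN; rewrite ltnn => /esym/negbT /=;
    rewrite -leNgt.
by apply: le_trans yN _; rewrite ler_pM2r // ler_nat ltnW.
Qed.

End levels.

Section finite_unions.
Context {R : realType} {T : eqType}.
Implicit Types (F : T -> set R) (s : seq T).

Lemma bigsetUP F s x :
  (\big[setU/set0]_(i <- s) F i) x <-> exists2 i, i \in s & F i x.
Proof.
elim: s => [|j s IH]; first by rewrite big_nil; split=> [|[]].
rewrite big_cons; split=> [[Fx|/IH[i si Fx]]|[i]].
- by exists j; rewrite ?mem_head.
- by exists i => //; rewrite inE si orbT.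
- by rewrite inE => /orP[/eqP ->|si] Fx; [left|right; apply/IH; exists i].
Qed.

Lemma measurable_bigsetU F s : (forall i, measurable (F i)) ->
  measurable (\big[setU/set0]_(i <- s) F i).
Proof.
move=> mF; elim: s => [|j s IH]; rewrite ?big_nil ?big_cons //.
exact: measurableU.
Qed.

Lemma lebesgue_bigsetU_le F s : (forall i, measurable (F i)) ->
  (mu (\big[setU/set0]_(i <- s) F i) <= \sum_(i <- s) mu (F i))%E.
Proof.
move=> mF; elim: s => [|j s IH]; rewrite ?big_nil ?big_cons ?measure0 //.
apply: le_trans (leeD2l _ IH); apply: measureU2; first exact: mF.
exact: measurable_bigsetU.
Qed.

Lemma lebesgue_bigsetU F s : uniq s -> (forall i, measurable (F i)) ->
  (forall i j, i \in s -> j \in s -> i != j -> F i `&` F j = set0) ->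
  mu (\big[setU/set0]_(i <- s) F i) = (\sum_(i <- s) mu (F i))%E.
Proof.
move=> + mF; elim: s => [|j s IH]; rewrite ?big_nil ?big_cons ?measure0 //=.
move=> /andP[js us] dF; rewrite lebesgueU //.
- rewrite IH // => i i' si si' ii'; apply: dF => //; rewrite inE ?si ?si' orbT //.
- exact: measurable_bigsetU.
- rewrite -subset0 => x [Fj /bigsetUP[i si Fi]].
  have ji : j != i by apply: contraNneq js => ->.
  by rewrite -(dF j i) ?inE ?eqxx ?si ?orbT.
Qed.

End finite_unions.

Section equal_pieces.
Context {R : realType}.
Implicit Types (A W : set R).

Lemma equal_pieces A (eta : R) n : measurable A -> A `<=` [set t | 0 <= t] ->
  0 <= eta -> (mu A < +oo)%E -> ((n%:R * eta)%:E <= mu A)%E ->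
  exists C : nat -> set R,
    (forall i, (i < n)%N -> [/\ measurable (C i), C i `<=` A & mu (C i) = eta%:E])
    /\ (forall i j, (i < n)%N -> (j < n)%N -> i != j -> C i `&` C j = set0).
Proof.
move=> mA A0 eta0; elim: n A mA A0 => [|n IH] A mA A0 Afin An.
  by exists (fun=> set0).
have [|S [mS _ AS]] := initial_segment A eta mA A0 eta0.
  apply: le_trans An; rewrite lee_fin ler_peMl // ler1n.
  by [].
have mAS : measurable (A `&` S) by exact: measurableI.
have mAD : measurable (A `\` (A `&` S)) by exact: measurableD.
have [||||C [CP Cdisj]] := IH (A `\` (A `&` S)).
- exact: mAD.
- by move=> s [/A0].
- by apply: le_lt_trans Afin; apply: le_lebesgue => // s [].
- rewrite lebesgueD ?AS // leeBrDr // -EFinD; apply: le_trans An.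
  by rewrite lee_fin -natr1 mulrDl mul1r.
exists (fun i => if i is i'.+1 then C i' else A `&` S); split.
  case=> [_|i]; first by split=> // s [].
  by rewrite ltnS => /CP[mC CA Ceta]; split => // s /CA[].
case=> [|i] [|j] //=.
- rewrite ltnS => _ jn _; rewrite -subset0 => s [ASs Cs].
  by have [_ CA _] := CP _ jn; have [] := CA _ Cs.
- rewrite ltnS => jn _ _; rewrite -subset0 => s [Cs ASs].
  by have [_ CA _] := CP _ jn; have [] := CA _ Cs.
- by rewrite !ltnS => iN jN ij; exact: Cdisj.
Qed.

(** One size serves all classes of [e], so that pieces of different classes can later be exchanged.
    Cutting as many pieces as fit leaves less than [eta] in each class, and [eta] is [eps] divided
    by more than the number of classes. *)
Lemma equal_cells (T : finType) (e : R -> T) W (eps : R) : measurable W ->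
  (forall tau, measurable [set s | W s /\ e s = tau]) ->
  W `<=` [set t | 0 <= t] -> (mu W < +oo)%E -> 0 < eps ->
  exists (eta : R) (P : finType) (tag : P -> T) (C : P -> set R), [/\ 0 < eta,
    forall p, [/\ measurable (C p), C p `<=` [set s | W s /\ e s = tag p] &
      mu (C p) = eta%:E],
    forall p q, p != q -> C p `&` C q = set0 &
    (mu (W `\` \big[setU/set0]_(p : P) C p) <= eps%:E)%E].
Proof.
move=> mW me W0 Wfin eps0; pose Wt tau := [set s | W s /\ e s = tau].
have WtW tau : Wt tau `<=` W by move=> s [].
have Wtfin tau : (mu (Wt tau) < +oo)%E.
  by apply: le_lt_trans Wfin; apply: le_lebesgue => //; exact: me.
have WtE tau : mu (Wt tau) = (fine (mu (Wt tau)))%:E.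
  by rewrite fineK // ge0_fin_numE.
pose eta := eps / #|T|.+1%:R.
have eta0 : 0 < eta by rewrite divr_gt0.
pose n tau := Num.truncn (fine (mu (Wt tau)) / eta).
have nP tau : (n tau)%:R * eta <= fine (mu (Wt tau)) < (n tau).+1%:R * eta.
  rewrite -ler_pdivlMr // -ltr_pdivrMr //; apply: truncn_itv.
  by rewrite divr_ge0 ?fine_ge0 // ltW.
have /choice[C CP] tau : exists C : nat -> set R,
    (forall i, (i < n tau)%N ->
       [/\ measurable (C i), C i `<=` Wt tau & mu (C i) = eta%:E]) /\
    (forall i j, (i < n tau)%N -> (j < n tau)%N -> i != j -> C i `&` C j = set0).
  apply: equal_pieces; [exact: me| |exact: ltW|exact: Wtfin|].
    by move=> s [Ws _]; exact: W0.
  by rewrite WtE lee_fin; have /andP[] := nP tau.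
have CPo tau (i : 'I_(n tau)) :
    [/\ measurable (C tau i), C tau i `<=` Wt tau & mu (C tau i) = eta%:E].
  exact: (CP tau).1.
pose CT tau := \big[setU/set0]_(i : 'I_(n tau)) C tau i.
have mCT tau : measurable (CT tau).
  by apply: measurable_bigsetU => i; have [] := CPo tau i.
have CTW tau : CT tau `<=` Wt tau.
  by move=> s /bigsetUP[i _ Cs]; have [_ CW _] := CPo tau i; exact: CW.
have muCT tau : mu (CT tau) = ((n tau)%:R * eta)%:E.
  rewrite /CT lebesgue_bigsetU ?index_enum_uniq //.
  - under eq_bigr => i _ do have [_ _ ->] := CPo tau i.
    by rewrite sumEFin sumr_const card_ord mulr_natl.
  - by move=> i; have [] := CPo tau i.
  - by move=> i j _ _ ij; apply: (CP tau).2.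
pose P : finType := {tau : T & 'I_(n tau)}.
exists eta, P, (fun p => tag p), (fun p : P => C (tag p) (tagged p)).
split=> //.
- move=> [t1 i1] [t2 i2] /=; have [t12|t12] := eqVneq t1 t2.
    case: t2 / t12 i2 => i2 pq; apply: (CP t1).2 => //.
    by apply: contraNneq pq => /val_inj ->.
  move=> _; rewrite -subset0 => s [C1 C2].
  have [_ /(_ _ C1)[_ es1] _] := CPo t1 i1.
  have [_ /(_ _ C2)[_ es2] _] := CPo t2 i2.
  by case/eqP: t12; rewrite -es1.
- apply: (@le_trans _ _ (mu (\big[setU/set0]_(tau : T) (Wt tau `\` CT tau)))).
    apply: le_lebesgue.
    + apply: measurableD => //; apply: measurable_bigsetU => p.
      by have [] := CPo (tag p) (tagged p).
    + by apply: measurable_bigsetU => tau; apply: measurableD;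
        [exact: me|exact: mCT].
    move=> s [Ws nCs]; apply/bigsetUP; exists (e s); rewrite ?mem_index_enum //.
    split=> // /bigsetUP[i _ Cs]; apply: nCs; apply/bigsetUP.
    by exists (Tagged (fun tau => 'I_(n tau)) i); rewrite ?mem_index_enum.
  apply: le_trans (lebesgue_bigsetU_le _ _ _) _.
    by move=> tau; apply: measurableD; [exact: me|exact: mCT].
  apply: (@le_trans _ _ (\sum_(tau : T) eta%:E)%E).
    apply: lee_sum => tau _; rewrite lebesgueD //; last exact: me.
    rewrite muCT WtE -EFinB lee_fin.
    by have /andP[_ /ltW] := nP tau; rewrite -natr1 mulrDl mul1r; lra.
  rewrite sumEFin sumr_const lee_fin -mulr_natr /eta -mulrA ger_pMr //.
  by rewrite mulrC ler_pdivrMr // mul1r ler_nat cardT.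
Qed.

End equal_pieces.

(** * Step functions on pieces of equal measure *)

Section step_functions.
Context {R : realType} {P : finType}.
Variables (I : set R) (C : P -> set R) (eta : R).
Hypothesis mC : forall p, measurable (C p).
Hypothesis CI : forall p, C p `<=` I.
Hypothesis muC : forall p, mu (C p) = eta%:E.
Hypothesis Cdisj : forall p q, p != q -> C p `&` C q = set0.

Definition stepf (w : P -> R) (t : R) : R := \sum_p w p * \1_(C p) t.

Lemma stepf_in w p t : C p t -> stepf w t = w p.
Proof.
move=> Ct; rewrite /stepf (bigD1 p) //= indicE mem_set // mulr1.
rewrite big1 ?addr0 // => q qp; rewrite indicE memNset ?mulr0 // => Cq.
by have : (C q `&` C p) t by []; rewrite Cdisj.
Qed.

Lemma stepf_out w t : (forall p, ~ C p t) -> stepf w t = 0.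
Proof.
by move=> nC; rewrite /stepf big1 // => p _; rewrite indicE memNset ?mulr0.
Qed.

Lemma measurable_stepf w D : measurable_fun D (stepf w).
Proof.
apply: measurable_sum => p; apply: measurable_funM; first exact: measurable_cst.
exact: measurable_funTS (measurable_indic _).
Qed.

Lemma stepf_distribution w l : 0 <= l ->
  mu [set s | I s /\ l < `|stepf w s|] =
  (#|[pred p | l < `|w p|]|%:R * eta)%:E.
Proof.
move=> l0.
rewrite (_ : [set s | _] =
    \big[setU/set0]_(p <- enum [pred p | l < `|w p|]) C p).
  rewrite lebesgue_bigsetU ?enum_uniq //; last by move=> p q _ _; exact: Cdisj.
  under eq_bigr do rewrite muC.
  by rewrite sumEFin big_const_seq count_predT iter_addr_0 -cardE mulr_natl.
apply/seteqP; split=> s; last first.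
  by move=> /bigsetUP[p]; rewrite mem_enum inE => lp Cs; split;
    [exact: CI Cs|rewrite (stepf_in w p)].
move=> [Is]; have [[p Cp]|nC] := pselect (exists p, C p s).
  rewrite (stepf_in w p) // => lp; apply/bigsetUP; exists p => //.
  by rewrite mem_enum inE.
rewrite stepf_out ?normr0 ?ltNge ?l0 // => p Cp; apply: nC; by exists p.
Qed.

End step_functions.

Section in_ball_step.
Context {R : realType} {I : set R}.
Hypothesis mI : measurable I.
Context {E : banach_function_space I}.
Hypothesis hsym : symmetric_space E.

(** The distribution of such a step function only counts indices, so neither the order of the values
    nor the place of the pieces matters. It serves both for transpositions on fixed pieces and for
    moving the pieces to the target cells. *)
Lemma in_ball_stepf_perm (P : finType) (C C' : P -> set R) eta c w
    (s : {perm P}) :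
  (forall p, [/\ measurable (C p), C p `<=` I & mu (C p) = eta%:E]) ->
  (forall p, [/\ measurable (C' p), C' p `<=` I & mu (C' p) = eta%:E]) ->
  (forall p q, p != q -> C p `&` C q = set0) ->
  (forall p q, p != q -> C' p `&` C' q = set0) ->
  in_ball (E := E) c (stepf C' w) -> in_ball (E := E) c (stepf C (w \o s)).
Proof.
move=> CP C'P Cd C'd; apply: in_ball_equimeasurable => //.
- by apply: measurable_stepf => p; have [] := CP p.
- by apply: measurable_stepf => p; have [] := C'P p.
move=> l l0; rewrite (stepf_distribution I C eta) //; first last.
- by move=> p; have [] := CP p.
- by move=> p; have [] := CP p.
- by move=> p; have [] := CP p.
rewrite (stepf_distribution I C' eta) //; first last.
- by move=> p; have [] := C'P p.
- by move=> p; have [] := C'P p.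
- by move=> p; have [] := C'P p.
congr ((_%:R * _)%:E); rewrite -(card_imset _ (@perm_inj _ s)) ?inE.
apply: eq_card => p; rewrite inE; apply/imsetP/idP => [[q]|lp].
  by rewrite !inE => lq ->.
by exists (s^-1%g p); rewrite ?inE /= permKV.
Qed.

End in_ball_step.

(** * Rearrangement on cells *)

Section cellwise.
Context {R : realType} {I : set R} {n : nat}.
Hypothesis mI : measurable I.
Hypothesis I0 : I `<=` [set t | 0 <= t].
Variables (lab lab' : R -> 'I_n) (b : 'I_n -> R).
Local Notation A j := [set s | I s /\ lab s = j].
Hypothesis mA : forall j, measurable (A j).
Hypothesis lab'P : forall j t, I t /\ lab' t = j <->
  b j <= t /\ ((t - b j)%:E < mu (A j))%E.

(* The decreasing rearrangement of the restriction of [f] to the cell [A j],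
   placed on the interval of [t]'s with [lab' t = j]. *)
Definition cell_rearr (f : R -> R) (t : R) : \bar R :=
  rearr (A (lab' t)) (EFin \o f) (t - b (lab' t)).

Context {E : banach_function_space I}.
Hypothesis hsym : symmetric_space E.
Hypothesis hfatou : fatou_property E.

Lemma lt_cell_rearr f t l : measurable_fun I f -> 0 <= l ->
  (l%:E < cell_rearr f t)%E =
  ((t - b (lab' t))%:E < d_ (A (lab' t)) (EFin \o f) l)%E.
Proof.
move=> mf l0; apply: lt_rearr => //; apply/measurable_EFinP.
by apply: measurable_funS mf => // s [].
Qed.

Section key.
Context {K : finType}.
Variables (f h : K -> R -> R) (c : R).
Hypothesis mf : forall k, measurable_fun I (f k).
Hypothesis f0 : forall k s, 0 <= f k s.
Hypothesis fh : {ae mu, forall t, I t ->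
  forall k, cell_rearr (f k) t = (h k t)%:E}.
Hypothesis hc : in_ball (E := E) c (fun t => \sum_k h k t).

(** The discrete form of the norm inequality. Round the [f k] down and cut the part up to [M] into
    equal pieces on which all the rounded values are constant. The sum of the values sorted within
    each cell is dominated by the sum of the [h k] on pieces of the target cells, and
    [convex_perm_sort] undoes the sorting. *)
Lemma cell_step (N : nat) (delta M eps : R) : 0 < delta -> 0 < eps ->
  exists (G : R -> R) (S : set R), [/\ in_ball (E := E) c G, measurable S,
    (mu ([set s | I s /\ (s <= M)%R] `\` S) <= eps%:E)%E &
    forall s, S s -> G s = \sum_k (lev delta N (f k s))%:R * delta].
Proof.
move=> d0 eps0; pose W := [set s | I s /\ s <= M].
have mW : measurable W.
  rewrite (_ : W = I `&` `]-oo, M]%classic).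
    by apply: measurableI => //; exact: measurable_itv.
  by apply/seteqP; split=> s /=; rewrite in_itv /= => -[].
(* A piece has to determine its cell and the rounded values of all [f k] at once, since one family
   of pieces must serve the whole sum. *)
pose T : finType := ('I_n * {ffun K -> 'I_N.+1})%type.
pose e s : T := (lab s, [ffun k => inord (lev delta N (f k s))]).
have mlev k (j : nat) : measurable [set s | W s /\ (j <= lev delta N (f k s))%N].
  have [jN|Nj] := leqP j N; last first.
    rewrite (_ : [set s | _] = set0) // -subset0 => s [_].
    by apply/negP; rewrite -ltnNge (leq_ltn_trans (lev_le _ _ _)).
  have [->|j0] := eqVneq j 0%N.
    rewrite (_ : [set s | _] = W) //.
    by apply/seteqP; split=> [s []|s Ws]//; split.
  rewrite (_ : [set s | _] = W `&` [set s | I s /\ j%:R * delta < `|f k s|]).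
    by apply: measurableI => //; exact: measurable_gt_abs.
  apply/seteqP; split=> s.
    move=> [Ws]; rewrite leq_lev // (negbTE j0) /= => jf; split=> //.
    by split; [case: Ws|rewrite ger0_norm].
  move=> [Ws [_]]; rewrite ger0_norm // => jf; split => //.
  by rewrite leq_lev // (negbTE j0).
have [||||eta [P [tag [C [eta0 CP Cd CW]]]]] :=
  @equal_cells R T e W eps _ _ _ _ eps0.
- exact: mW.
- move=> [j phi].
  rewrite (_ : [set s | _] = (W `&` A j) `&` \big[setI/setT]_(k : K)
      ([set s | W s /\ (phi k <= lev delta N (f k s))%N] `\`
       [set s | W s /\ ((phi k).+1 <= lev delta N (f k s))%N])).
    apply: measurableI; first by do 2 apply: measurableI => //.
    by apply: bigsetI_measurable => k _; apply: measurableD; exact: mlev.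
  rewrite -bigcap_seq; apply/seteqP; split=> s.
    move=> [Ws [<- <-]]; split; first by split => //; split => //; case: Ws.
    move=> k _; rewrite /= ffunE inordK ?ltnS ?lev_le //; split=> //.
    by rewrite ltnn => -[].
  move=> [[Ws [_ <-]] H]; split=> //; congr pair; apply/ffunP => k.
  rewrite ffunE; apply/val_inj; rewrite /= inordK ?ltnS ?lev_le //.
  have [|[_ le1] nle2] := H k; first by rewrite /= mem_index_enum.
  apply/eqP; rewrite eqn_leq le1 andbT leqNgt; apply/negP => lt2.
  by apply: nle2; split.
- by move=> s [/I0].
- apply: (@le_lt_trans _ _ (mu (`[0, M]%classic : set R))).
    apply: le_lebesgue; [exact: mW|exact: measurable_itv|].
    by move=> s [/I0 /= s0 sM]; rewrite in_itv /= s0.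
  by rewrite lebesgue_measure_itv /=; case: ifP; rewrite -?EFinB ?ltry.
have CPI p : [/\ measurable (C p), C p `<=` I & mu (C p) = eta%:E].
  by have [mCp CpW muCp] := CP p; split => // s /CpW[[]].
pose ell p := (tag p).1.
pose v k p : R := ((tag p).2 k)%:R * delta.
have Clab p s : C p s -> lab s = ell p.
  by move=> Cs; have [_ CpW _] := CP p; rewrite /ell -(CpW _ Cs).2.
have vE k p s : C p s -> v k p = (lev delta N (f k s))%:R * delta.
  move=> Cs; have [_ CpW _] := CP p; rewrite /v -(CpW _ Cs).2.
  by rewrite ffunE inordK // ltnS lev_le.
have card_le (X : {pred P}) (B : set R) : measurable B ->
    (forall q, q \in X -> C q `<=` B) -> ((#|X|%:R * eta)%:E <= mu B)%E.
  move=> mB XB; apply: (@le_trans _ _ (mu (\big[setU/set0]_(q <- enum X) C q))).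
    rewrite lebesgue_bigsetU ?enum_uniq //.
    - under eq_bigr => q _ do have [_ _ ->] := CP q.
      by rewrite sumEFin big_const_seq count_predT iter_addr_0 -cardE mulr_natl.
    - by move=> q; have [] := CP q.
    - by move=> p q _ _; exact: Cd.
  apply: le_lebesgue => //.
    by apply: measurable_bigsetU => q; have [] := CP q.
  by move=> s /bigsetUP[q]; rewrite mem_enum => /XB; apply.
(* An arbitrary enumeration of the pieces. Within each cell it fixes the order in which values are
   sorted and in which the target pieces [C'] are laid side by side from the start of the target
   cell. *)
pose rk (p : P) : nat := enum_rank p.
pose pos p := #|[pred q | (ell q == ell p) && (rk q < rk p)%N]|.
have posS p : (pos p).+1 = #|[pred q | (ell q == ell p) && (rk q <= rk p)%N]|.
  rewrite (cardD1 p) !inE eqxx leqnn add1n; congr _.+1; apply: eq_card => q.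
  rewrite !inE; have [->|qp] := eqVneq q p; first by rewrite ltnn andbF.
  by rewrite ltn_neqAle (inj_eq val_inj) (inj_eq enum_rank_inj) qp.
pose C' p := [set` `[b (ell p) + (pos p)%:R * eta,
                     b (ell p) + (pos p).+1%:R * eta[%R].
have C'b p t : C' p t ->
    b (ell p) <= t /\ t - b (ell p) < (pos p).+1%:R * eta.
  rewrite /C' /= in_itv /= => /andP[bt tb]; split.
    by apply: le_trans bt; rewrite lerDl mulr_ge0 // ltW.
  by rewrite ltrBlDl.
(* They fit: the original pieces of a cell are disjoint and contained in it, so their total measure
   is at most the length of the target cell. *)
have C'I p t : C' p t -> I t /\ lab' t = ell p.
  move=> /C'b[bt tb]; apply/lab'P; split=> //.
  apply: (@lt_le_trans _ _ ((pos p).+1%:R * eta)%:E); first by rewrite lte_fin.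
  rewrite posS; apply: card_le => // q; rewrite inE => /andP[/eqP eqp _] s Cs.
  by split; [have [_ + _] := CPI q; exact|rewrite -eqp; exact: Clab].
have C'P p : [/\ measurable (C' p), C' p `<=` I & mu (C' p) = eta%:E].
  split; first exact: measurable_itv.
    by move=> t /C'I[].
  rewrite /C' lebesgue_measure_itv /= lte_fin ltrD2l ltr_pM2r // ltr_nat ltnSn.
  by rewrite -EFinB; congr EFin; rewrite -natr1; lra.
have C'd p q : p != q -> C' p `&` C' q = set0.
  wlog rpq : p q / (rk p <= rk q)%N.
    move=> wl pq; have [/wl|/ltnW/wl] := leqP (rk p) (rk q); first exact.
    by rewrite setIC; apply; rewrite eq_sym.
  move=> pq; rewrite -subset0 => t [C'p C'q].
  have [_ lp] := C'I _ _ C'p; have [_ lq] := C'I _ _ C'q.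
  have epq : ell p = ell q by rewrite -lp.
  have : ((pos p).+1 <= pos q)%N.
    rewrite posS; apply/subset_leq_card/fintype.subsetP => r.
    rewrite !inE epq => /andP[-> rp] /=; apply: leq_ltn_trans rp _.
    by rewrite ltn_neqAle rpq (inj_eq val_inj) (inj_eq enum_rank_inj) pq.
  move: C'p C'q; rewrite /C' /= !in_itv /= -epq => /andP[_ tp] /andP[qt _].
  apply/negP; rewrite -ltnNge -(ltr_nat R) -(ltr_pM2r eta0).
  by rewrite -(ltrD2l (b (ell p))); exact: le_lt_trans tp.
pose Q w := in_ball (E := E) c (stepf C w).
have Qconv w w' t : Q w -> Q w' -> 0 <= t <= 1 ->
    Q (fun p => t * w p + (1 - t) * w' p).
  move=> Qw Qw' t01; have := in_ball_convex _ _ _ _ t01 Qw Qw'.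
  congr in_ball; apply/funext => s; rewrite /stepf !mulr_sumr -big_split /=.
  by apply: eq_bigr => p _; rewrite [RHS]mulrDl !mulrA.
have Qperm w p q : Q w -> Q (w \o tperm p q).
  exact: (in_ball_stepf_perm mI hsym P C C eta c w (tperm p q) CPI CPI Cd Cd).
have [s [lab_s mono Qs]] :=
  convex_perm_sort R P K 'I_n rk ell Q v Qconv Qperm.
exists (stepf C (fun p => \sum_k v k p)), (\big[setU/set0]_(p : P) C p).
split=> //; last 2 first.
- by apply: measurable_bigsetU => p; have [] := CP p.
- move=> t /bigsetUP[p _ Ct]; rewrite (stepf_in C Cd _ p) //.
  by apply: eq_bigr => k _; exact: vE.
apply: Qs; pose w p := \sum_k v k (s k p).
have -> : (fun p => \sum_k v k (s k p)) = w \o (1 : {perm P})%g.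
  by apply/funext => p; rewrite /= perm1.
apply: (in_ball_stepf_perm mI hsym P C C' eta) => //.
apply: in_ball_solid hc.
  by apply: measurable_stepf => p; have [] := C'P p.
apply: aeS fh => t fht It.
have h0 k : 0 <= h k t by rewrite -lee_fin -fht // rearr_ge0.
have [[p C't]|nC'] := pselect (exists p, C' p t); last first.
  by rewrite stepf_out ?normr0 // => p C't; apply: nC'; exists p.
rewrite (stepf_in C' C'd _ p) // !ger0_norm; last 2 first.
- by apply: sumr_ge0 => k _.
- by apply: sumr_ge0 => k _; rewrite mulr_ge0 // ltW.
(* If the sorted value at [p] exceeded [h k t], so would the values at all [(pos p).+1] places of
   the cell up to [p]. Then [f k > h k t] on a part of the cell of measure greater than
   [t - b (ell p)], and the cell rearrangement at [t] would exceed [h k t], its own value. *)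
apply: ler_sum => k _; rewrite leNgt; apply/negP => hv.
suff : ((h k t)%:E < cell_rearr (f k) t)%E by rewrite fht // ltxx.
rewrite lt_cell_rearr //; have [_ ->] := C'I _ _ C't.
have [_ tb] := C'b _ _ C't.
apply: (@lt_le_trans _ _ ((pos p).+1%:R * eta)%:E); first by rewrite lte_fin.
rewrite posS -(card_imset _ (@perm_inj _ (s k))); apply: card_le.
  apply: measurable_d => //; apply/measurable_EFinP.
  by apply: measurable_funS (mf k) => // r [].
move=> _ /imsetP[q + ->] r Cr; rewrite inE => /andP[/eqP eqp rqp].
split; first split.
- by have [_ CqI _] := CPI (s k q); exact: CqI.
- by rewrite (Clab _ _ Cr) lab_s.
rewrite /= ger0_norm // lte_fin; apply: (lt_le_trans hv).
apply: (@le_trans _ _ (v k (s k q))); last by rewrite (vE _ _ _ Cr) lev_lb.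
have [->//|qp] := eqVneq q p; apply: mono => //.
by rewrite ltn_neqAle rqp (inj_eq val_inj) (inj_eq enum_rank_inj) qp.
Qed.

(** Apply [cell_step] with width 1 / (m+1), highest threshold m+1 and exceptional sets of summable
    measures. By Borel-Cantelli almost every point lies in finitely many of these, so the step
    functions converge a.e. to the sum and the Fatou property keeps the limit in the ball. *)
Lemma cell_rearr_sum : in_ball (E := E) c (fun t => \sum_k f k t).
Proof.
have /choice[G GP] m : exists G : R -> R, exists S : set R,
    [/\ in_ball (E := E) c G, measurable S,
    (mu ([set s | I s /\ (s <= m%:R)%R] `\` S) <= (1 / (2 ^ m.+1)%:R)%:E)%E &
    forall s, S s -> G s =
      \sum_k (lev m.+1%:R^-1 (m.+1 ^ 2)%N (f k s))%:R * m.+1%:R^-1].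
  by apply: cell_step; rewrite ?invr_gt0 ?divr_gt0 // ltr0n expn_gt0.
have {GP}/choice[S GP] := GP.
pose F m := [set s | I s /\ s <= m%:R] `\` S m.
have mF m : measurable (F m).
  apply: measurableD; last by have [] := GP m.
  rewrite (_ : [set s | _] = I `&` `]-oo, m%:R]%classic).
    by apply: measurableI => //; exact: measurable_itv.
  by apply/seteqP; split=> s /=; rewrite in_itv /= => -[].
have F0 : mu (lim_sup_set F) = 0.
  apply: lim_sup_set_cvg0 => //.
  apply: (@le_lt_trans _ _ (\sum_(m <oo) (1 / (2 ^ m.+1)%:R)%:E)%E).
    by apply: lee_nneseries => // m _; have [] := GP m.
  apply: le_lt_trans (epsilon_trick0 _ ler01) _; exact: ltry.
have msum : measurable_fun I (fun t => \sum_k f k t).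
  by apply: measurable_sum => k; exact: mf.
apply: (in_ball_fatou hfatou c G) => //; first by move=> m; have [] := GP m.
have aF : {ae mu, forall t, ~ lim_sup_set F t}.
  exists (lim_sup_set F); split=> //; last by move=> t /= /contrapT.
  apply: bigcapT_measurable => m; apply: bigcup_measurable => j _; exact: mF.
apply: aeS aF => t nF It.
have [n0 n0P] : exists n0 : nat, forall m, (n0 <= m)%N -> ~ F m t.
  apply: contrapT => H; apply: nF => m _; apply: contrapT => Hm; apply: H.
  by exists m => j mj Fj; apply: Hm; exists j.
(* One bound for the point and for all the values at it: if [B <= m], then [t] lies before the cut
   at [m] and every [f k t] below the highest threshold. *)
pose B := t + \sum_k f k t.
have fB k : f k t <= B.
  rewrite /B (bigD1 k) //= addrCA lerDl; apply: addr_ge0; first exact: I0.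
  by apply: sumr_ge0 => i _; exact: f0.
have tB : t <= B by rewrite lerDl; apply: sumr_ge0 => k _; exact: f0.
have Gt m : (n0 <= m)%N -> (Num.bound B <= m)%N ->
    `|(\sum_k f k t) - G m t| <= #|K|%:R / m.+1%:R.
  move=> nm Bm.
  have Bm' : B <= m%:R.
    apply: (@le_trans _ _ (Num.bound B)%:R); last by rewrite ler_nat.
    by apply/ltW/archi_boundP; apply: le_trans tB; exact: I0.
  have St : S m t.
    apply: contrapT => nS; apply: (n0P _ nm); split=> //; split=> //.
    exact: le_trans Bm'.
  have [_ _ _ ->] := GP m => //; rewrite -sumrB.
  apply: le_trans (ler_norm_sum _ _ _) _.
  rewrite mulr_natl -sumr_const; apply: ler_sum => k _.
  have d0 : 0 < m.+1%:R^-1 :> R by rewrite invr_gt0.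
  have ub : f k t <= (m.+1 ^ 2)%:R / m.+1%:R.
    rewrite natrX expr2 mulfK //; apply: le_trans (fB k) _.
    by apply: le_trans Bm' _; rewrite ler_nat.
  have := lev_ub _ _ _ d0 ub; have := lev_lb _ (m.+1 ^ 2)%N _ d0 (f0 k t).
  move=> lb; rewrite ger0_norm ?subr_ge0 // lerBlDl.
  by rewrite -[(lev _ _ _).+1%:R]natr1 mulrDl mul1r.
apply: cvg_norm; apply/cvgrPdist_le => e e0.
have e1 : 0 < e / #|K|.+1%:R by rewrite divr_gt0.
have [n1 _ n1P] := near_infty_natSinv_lt (PosNum e1).
near=> m.
apply: le_trans (Gt m _ _) _.
- by near: m; exact: nbhs_infty_ge.
- by near: m; exact: nbhs_infty_ge.
have : m.+1%:R^-1 < e / #|K|.+1%:R.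
  by apply: n1P; near: m; exact: nbhs_infty_ge.
rewrite ltr_pdivlMr // mulrC => Ke; apply/ltW/(le_lt_trans _ Ke).
by rewrite ler_wpM2r // ler_nat.
Unshelve. all: by end_near. Qed.

End key.
End cellwise.

(** * Equimeasurability of the cellwise rearrangement *)

Section shifted_intervals.
Context {R : realType}.
Implicit Types (b : R) (x : \bar R).

Lemma shift_itv b x : (0 <= x)%E -> [set t | b <= t /\ ((t - b)%:E < x)%E] =
  [set` (if x is r%:E then `[b, b + r[ else `[b, +oo[)%R].
Proof.
case: x => [r| |] // r0; apply/seteqP; split => t /=; rewrite in_itv /=.
- by rewrite lte_fin => -[-> /=]; rewrite ltrBlDl.
- by move=> /andP[bt]; rewrite lte_fin ltrBlDl.
- by move=> [->].
- by rewrite andbT ltry.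
Qed.

Lemma measurable_shift_itv b x : (0 <= x)%E ->
  measurable [set t | b <= t /\ ((t - b)%:E < x)%E].
Proof. by move=> x0; rewrite shift_itv //; case: x x0. Qed.

Lemma measure_shift_itv b x : (0 <= x)%E ->
  mu [set t | b <= t /\ ((t - b)%:E < x)%E] = x.
Proof.
move=> x0; rewrite shift_itv //.
case: x x0 => [r| |] // r0; rewrite lebesgue_measure_itv /=.
  rewrite lte_fin ltrDl; case: ltP => [_|]; first by rewrite -EFinB addrAC subrr add0r.
  by rewrite lee_fin in r0 => r0'; congr EFin; apply/le_anti/andP.
by rewrite ltry.
Qed.

End shifted_intervals.

Section equidistribution.
Context {R : realType}.
Implicit Types (A B : set R) (f g : R -> R).

Lemma measure_cells {n : nat} (I S : set R) (lab : R -> 'I_n) :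
  (forall j, measurable [set s | I s /\ lab s = j]) -> measurable S ->
  S `<=` I -> mu S = (\sum_(j < n) mu [set s | S s /\ lab s = j])%E.
Proof.
move=> mA mS SI.
have SE j : [set s | S s /\ lab s = j] = S `&` [set s | I s /\ lab s = j].
  apply/seteqP; split=> s; first by move=> [Ss <-]; do 2!split=> //; exact: SI.
  by move=> [Ss [_ ?]].
have mSj j : measurable [set s | S s /\ lab s = j].
  by rewrite SE; exact: measurableI.
rewrite -lebesgue_bigsetU ?index_enum_uniq //.
  congr (mu _); apply/seteqP; split=> s.
    by move=> Ss; apply/bigsetUP; exists (lab s); rewrite ?mem_index_enum.
  by move=> /bigsetUP[j _ []].
move=> i j _ _ ij; rewrite -subset0 => s [[_ si] [_ sj]].
by move: ij; rewrite -si sj eqxx.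
Qed.

(** The set where |f - v| > l consists of the points with f > l + v and of the complement of those
    with f >= v - l. The measure of the latter set is a left limit of the distribution function;
    taking complements requires finite measure, except for [v = 0], where there is nothing to
    subtract. *)
Lemma equidistributed_shift A B f g (v : R) : measurable A -> measurable B ->
  measurable_fun A f -> measurable_fun B g ->
  (forall s, 0 <= f s) -> (forall s, 0 <= g s) -> mu A = mu B ->
  (forall l, 0 <= l -> mu [set s | A s /\ l < f s] = mu [set s | B s /\ l < g s]) ->
  0 <= v -> v = 0 \/ (mu A < +oo)%E ->
  forall l, 0 <= l -> mu [set s | A s /\ l < `|f s - v|] =
                      mu [set s | B s /\ l < `|g s - v|].
Proof.
move=> mA mB mf mg f0 g0 AB fg v0 [-> l l0|Afin l l0].
  rewrite (_ : [set s | A s /\ _] = [set s | A s /\ l < f s]).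
    rewrite fg //; congr (mu _); apply/seteqP.
    by split=> s /= -[Bs]; rewrite subr0 ger0_norm.
  by apply/seteqP; split=> s /= -[Bs]; rewrite subr0 ger0_norm.
have gtE (D : set R) (u : R -> R) (r : R) : measurable D ->
    measurable_fun D u -> (forall s, 0 <= u s) ->
    measurable [set s | D s /\ r < u s].
  move=> mD mu' u0; have := measurable_gt_abs D u r mD mu'.
  by rewrite (_ : [set s | _ /\ r < `|u s|] = [set s | D s /\ r < u s]) //;
    apply/seteqP; split=> s /= -[Ds]; rewrite ger0_norm.
have split_dist (D : set R) (u : R -> R) : measurable D -> measurable_fun D u ->
    (forall s, 0 <= u s) -> (mu D < +oo)%E ->
    mu [set s | D s /\ l < `|u s - v|] =
    (mu [set s | D s /\ (l + v < u s)%R] +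
     (mu D - mu [set s | D s /\ (v - l <= u s)%R]))%E.
  move=> mD mu' u0 Dfin.
  have mge := measurable_ge D u (v - l) mD mu'.
  rewrite -lebesgueD //; last by move=> s [].
  rewrite -lebesgueU //; last 3 first.
  - exact: gtE.
  - exact: measurableD.
  - rewrite -subset0 => s [[Ds lv] [_]]; apply; split=> //=.
    by apply: le_trans (ltW lv); lra.
  congr (mu _); apply/seteqP; split=> s /=.
    move=> [Ds H].
    have [lv|lv] := ltP (l + v) (u s); first by left.
    right; split=> // -[_ vl]; move: H; apply/negP; rewrite -leNgt.
    by rewrite ler_norml; lra.
  move=> [[Ds lv]|[Ds nv]]; split=> //; rewrite ltNge ler_norml; apply/negP.
    by move=> /andP[]; lra.
  by move=> /andP[lv _]; apply: nv; split=> //; lra.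
have Bfin : (mu B < +oo)%E by rewrite -AB.
rewrite split_dist // [RHS]split_dist // AB fg ?addr_ge0 //; congr (_ + (_ - _))%E.
have [vl|vl] := leP (v - l) 0.
  have full (D : set R) (u : R -> R) : (forall s, 0 <= u s) ->
      [set s | D s /\ v - l <= u s] = D.
    move=> u0; apply/seteqP; split=> s; first by case.
    by move=> Ds; split=> //; exact: le_trans (u0 s).
  by rewrite !full.
have fin (D : set R) (u : R -> R) : measurable D ->
    measurable_fun D u -> (mu D < +oo)%E ->
    forall r, 0 < r -> (d_ D (EFin \o u) r < +oo)%E.
  move=> mD mu' Dfin r _; apply: le_lt_trans Dfin; apply: d_le_measure => //.
  exact/measurable_EFinP.
have cf := d_left_limit A f _ mA mf f0 vl (fin _ _ mA mf Afin).
have cg := d_left_limit B g _ mB mg g0 vl (fin _ _ mB mg Bfin).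
have dE (D : set R) (u : R -> R) (r : R) : (forall s, 0 <= u s) ->
    d_ D (EFin \o u) r = mu [set s | D s /\ r < u s].
  move=> u0; congr (mu _).
  by apply/seteqP; split=> s /= -[Ds]; rewrite ger0_norm // lte_fin.
have e : (fun n : nat => d_ A (EFin \o f) (v - l - (v - l) / n.+2%:R)) =
         (fun n : nat => d_ B (EFin \o g) (v - l - (v - l) / n.+2%:R)).
  apply/funext => n; rewrite !dE // fg // subr_ge0 ler_pdivrMr //.
  by rewrite ler_peMr ?ler1n // ltW.
rewrite e in cf.
have <- := cvg_lim (@ereal_hausdorff R) cf.
exact: (cvg_lim (@ereal_hausdorff R) cg).
Qed.

End equidistribution.

Section cell_distribution.
Context {R : realType} {I : set R} {n : nat}.
Hypothesis mI : measurable I.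
Variables (lab lab' : R -> 'I_n) (b : 'I_n -> R).
Local Notation A j := [set s | I s /\ lab s = j].
Local Notation B j := [set t | I t /\ lab' t = j].
Hypothesis mA : forall j, measurable (A j).
Hypothesis lab'P : forall j t, I t /\ lab' t = j <->
  b j <= t /\ ((t - b j)%:E < mu (A j))%E.
Variable f : R -> R.
Hypothesis mf : measurable_fun I f.
Hypothesis f0 : forall s, 0 <= f s.
Local Notation f' := (cell_rearr (I := I) lab lab' b f).

Lemma target_cellE j :
  B j = [set t | b j <= t /\ ((t - b j)%:E < mu (A j))%E].
Proof. by apply/seteqP; split=> t /lab'P. Qed.

Lemma measurable_target_cell j : measurable (B j).
Proof. by rewrite target_cellE; exact: measurable_shift_itv. Qed.

Lemma measure_target_cell j : mu (B j) = mu (A j).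
Proof. by rewrite target_cellE measure_shift_itv. Qed.

Let mfA j : measurable_fun (A j) (EFin \o f).
Proof. by apply/measurable_EFinP; apply: measurable_funS mf => // s []. Qed.

Lemma gt_cell_rearr j l : 0 <= l -> [set t | B j t /\ (l%:E < f' t)%E] =
  [set t | b j <= t /\ ((t - b j)%:E < d_ (A j) (EFin \o f) l)%E].
Proof.
move=> l0; apply/seteqP; split=> t.
  move=> [Bt]; rewrite (lt_cell_rearr mI lab lab' b mA) //.
  by have [It ->] := Bt; move/lab'P: Bt => [].
move=> [bt dt]; have Bt : B j t.
  by apply/lab'P; split=> //; apply: lt_le_trans dt _; exact: d_le_measure.
by split=> //; rewrite (lt_cell_rearr mI lab lab' b mA) //; case: Bt => _ ->.
Qed.

Lemma measure_gt_cell_rearr j l : 0 <= l ->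
  mu [set t | B j t /\ (l%:E < f' t)%E] = mu [set s | A j s /\ l < f s].
Proof.
move=> l0; rewrite gt_cell_rearr // measure_shift_itv ?d_ge0 //.
congr (mu _); apply/seteqP.
by split=> s /= -[As]; rewrite ger0_norm // lte_fin.
Qed.

Lemma measurable_cell_rearr : measurable_fun I f'.
Proof.
move=> _; apply: (measurability _ (ErealGenOInfty.measurableE R)) => //.
move=> _ [_ [r ->] <-].
have [r0|r0] := leP 0 r; last first.
  rewrite (_ : _ `&` _ = I) //; apply/seteqP; split => [t []//|t It].
  split=> //=; rewrite in_itv /= andbT; apply: lt_le_trans (rearr_ge0 _ _ _).
  by rewrite lte_fin.
rewrite (_ : _ `&` _ = \big[setU/set0]_(j < n) [set t | B j t /\ (r%:E < f' t)%E]).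
  apply: measurable_bigsetU => j; rewrite gt_cell_rearr //.
  by apply: measurable_shift_itv; exact: d_ge0.
apply/seteqP; split=> t.
  move=> [It /=]; rewrite in_itv /= andbT => rt; apply/bigsetUP.
  by exists (lab' t); rewrite ?mem_index_enum.
by move=> /bigsetUP[j _ [[It _] rt]]; split=> //=; rewrite in_itv /= andbT.
Qed.

Lemma d_cell_rearr l : 0 <= l -> d_ I f' l = d_ I (EFin \o f) l.
Proof.
move=> l0; rewrite /d_ (measure_cells I _ lab' measurable_target_cell); first last.
- by move=> s [].
- exact: measurable_d measurable_cell_rearr.
rewrite [RHS](measure_cells I _ lab mA); first last.
- by move=> s [].
- by apply: measurable_d => //; exact/measurable_EFinP.
apply: eq_bigr => j _; transitivity (mu [set t | B j t /\ (l%:E < f' t)%E]).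
  congr (mu _); apply/seteqP; split=> t /=.
    by move=> [[It]]; rewrite gee0_abs ?rearr_ge0.
  by move=> [[It lj] lt]; rewrite gee0_abs ?rearr_ge0.
rewrite measure_gt_cell_rearr //; congr (mu _); apply/seteqP; split=> s /=.
  by move=> [[Is lj] ls]; rewrite ger0_norm // lte_fin.
by move=> [[Is]]; rewrite ger0_norm // lte_fin.
Qed.

(** This brings approximation back from the target cells to the original ones: distances to
    functions constant on the cells survive the rearrangement. A cell of infinite measure is
    harmless if the constant there is 0. *)
Lemma cell_rearr_shift (h : R -> R) (v : 'I_n -> R) : measurable_fun I h ->
  {ae mu, forall t, I t -> f' t = (h t)%:E} ->
  (forall j, 0 <= v j) -> (forall j, v j = 0 \/ (mu (A j) < +oo)%E) ->
  forall l, 0 <= l -> mu [set s | I s /\ l < `|h s - v (lab' s)|] =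
                      mu [set s | I s /\ l < `|f s - v (lab s)|].
Proof.
move=> mh f'h v0 vfin l l0.
have mv (lb : R -> 'I_n) : (forall j, measurable [set s | I s /\ lb s = j]) ->
    measurable_fun I (fun s => v (lb s)).
  move=> mlb _ Y mY.
  rewrite (_ : _ `&` _ = \big[setU/set0]_(j <- [seq j <- index_enum 'I_n | v j \in Y])
      [set s | I s /\ lb s = j]); first exact: measurable_bigsetU.
  apply/seteqP; split=> s.
    move=> [Is Ys]; apply/bigsetUP; exists (lb s) => //.
    by rewrite mem_filter mem_index_enum andbT mem_set.
  move=> /bigsetUP[j]; rewrite mem_filter => /andP[/set_mem Yj _] [Is lsj].
  by split=> //=; rewrite lsj.
have mB := measurable_target_cell.
(* [h] is nonnegative only almost everywhere, whereas [equidistributed_shift] wants this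
   everywhere. *)
pose g t := `|h t|.
have mg : measurable_fun I g.
  exact: (measurableT_comp (@normr_measurable R setT)).
transitivity (mu [set s | I s /\ l < `|g s - v (lab' s)|]).
  apply: ae_eq_measure.
  - by apply: measurable_gt_abs => //; apply: measurable_funB => //; exact: mv.
  - by apply: measurable_gt_abs => //; apply: measurable_funB => //; exact: mv.
  - apply: aeS f'h => t f'ht; split=> /= -[It]; rewrite /g;
    by rewrite (@ger0_norm _ (h t)) // -lee_fin -f'ht // rearr_ge0.
rewrite (measure_cells I _ lab' mB); first last.
- by move=> s [].
- by apply: measurable_gt_abs => //; apply: measurable_funB => //; exact: mv.
rewrite [RHS](measure_cells I _ lab mA); first last.
- by move=> s [].
- by apply: measurable_gt_abs => //; apply: measurable_funB => //; exact: mv.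
apply: eq_bigr => j _.
transitivity (mu [set s | B j s /\ l < `|g s - v j|]).
  congr (mu _); apply/seteqP; split=> s /=; first by move=> [[Is H] <-].
  by move=> [[Is <-] H].
transitivity (mu [set s | A j s /\ l < `|f s - v j|]); last first.
  congr (mu _); apply/seteqP; split=> s /=; first by move=> [[Is <-] H].
  by move=> [[Is H] <-].
have mgB : measurable_fun (B j) g by apply: measurable_funS mg => // s [].
apply: (equidistributed_shift (B j) (A j) g f (v j)) => //.
- by apply: measurable_funS mf => // s [].
- by move=> s; rewrite /g.
- exact: measure_target_cell.
- move=> r r0; rewrite -measure_gt_cell_rearr //; apply: ae_eq_measure.
  + rewrite (_ : [set s | _ /\ r < g s] = [set s | B j s /\ r < `|g s|]).
      exact: measurable_gt_abs.
    by apply/seteqP; split=> s /= -[Bs]; rewrite normr_id.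
  + by rewrite gt_cell_rearr //; apply: measurable_shift_itv; exact: d_ge0.
  + apply: aeS f'h => t f'ht; split=> /= -[[It lt]]; rewrite f'ht // lte_fin /g;
    by rewrite ger0_norm // -lee_fin -f'ht // rearr_ge0.
- by have [->|Afin] := vfin j; [left|right; rewrite measure_target_cell].
Qed.

End cell_distribution.

(** * Rotundity *)

Section rotundity.
Context {R : realType} {E : normedModType R}.
Implicit Types (x : E) (u : nat -> E) (k : nat).

Definition asymptotically_flat k x u : Prop :=
  forall phi : 'I_k -> nat -> nat,
    (forall i, {homo phi i : m n / (m < n)%N}) ->
    `|x + \sum_(i < k) u (phi i n)| @[n --> \oo] --> (k.+1%:R : R).

Lemma leq_homo (phi : nat -> nat) n : {homo phi : m n / (m < n)%N} ->
  (n <= phi n)%N.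
Proof.
by move=> h; elim: n => // n /leq_ltn_trans; apply; exact: h.
Qed.

Lemma cvg_subsequence (a : nat -> R) (l : R) (phi : nat -> nat) :
  {homo phi : m n / (m < n)%N} -> a n @[n --> \oo] --> l ->
  a (phi n) @[n --> \oo] --> l.
Proof.
move=> h al; apply: (cvg_comp phi a _ al) => P [N _ NP]; exists N => // n Nn.
by apply: NP; apply: leq_trans Nn _; exact: leq_homo.
Qed.

Lemma cvg_sum0 (K : Type) (s : seq K) (a : K -> nat -> R) :
  (forall i, a i n @[n --> \oo] --> (0 : R)) ->
  \sum_(i <- s) a i n @[n --> \oo] --> (0 : R).
Proof.
move=> a0; elim: s => [|i s IH].
  by under eq_fun do rewrite big_nil; exact: cvg_cst.
under eq_fun do rewrite big_cons.
by have := cvgD (a0 i) IH; rewrite addr0; apply.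
Qed.

Lemma norm_sum_le k x u (phi : 'I_k -> nat -> nat) n : `|x| <= 1 ->
  (forall n, `|u n| <= 1) -> `|x + \sum_(i < k) u (phi i n)| <= k.+1%:R.
Proof.
move=> x1 u1; apply: le_trans (ler_normD _ _) _; rewrite -nat1r lerD //.
apply: le_trans (ler_norm_sum _ _ _) _.
apply: (@le_trans _ _ (\sum_(i < k) 1)); first exact: ler_sum.
by rewrite sumr_const card_ord.
Qed.

(** Let all [k] subsequences be the sequence itself: the norm of [x + k u_n] tends to k + 1 and is
    at most 1 + k times the norm of [u_n]. *)
Lemma asymptotically_flat_norm_cvg k x u : (0 < k)%N -> `|x| = 1 ->
  (forall n, `|u n| <= 1) -> asymptotically_flat k x u ->
  `|u n| @[n --> \oo] --> (1 : R).
Proof.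
move=> k0 x1 u1 /(_ (fun=> id)) flat.
have k0' : 0 < k%:R :> R by rewrite ltr0n.
apply: (@squeeze_cvgr _ _ _ _
  (fun n => (`|x + \sum_(i < k) u n| - 1) / k%:R) (cst 1)).
- apply: nearW => n; rewrite u1 andbT ler_pdivrMr // lerBlDl.
  apply: le_trans (ler_normD _ _) _; rewrite x1 lerD2l sumr_const card_ord.
  by rewrite normrMn mulr_natr.
- have lim1 : (k.+1%:R - 1) / k%:R = 1 :> R.
    by rewrite -natr1 addrK divff // gt_eqF.
  have flat' := flat (fun i m n mn => mn).
  have := cvgM (cvgB flat' (cvg_cst (1 : R))) (cvg_cst (k%:R^-1 : R)).
  by rewrite lim1; apply.
- exact: cvg_cst.
Qed.

Lemma locally_fully_rotund_le k x u : (0 < k)%N ->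
  locally_fully_rotund_at k x -> (forall n, `|u n| <= 1) ->
  asymptotically_flat k x u -> `|u n - x| @[n --> \oo] --> (0 : R).
Proof.
move=> k0 [x1 rot] u1 flat; have uc := asymptotically_flat_norm_cvg _ _ _ k0 x1 u1 flat.
(* Where [u n = 0], any unit vector would do, as the distance to it is again [1 - |u n|]; [x] is one
   at hand. *)
pose v n := if `|u n| == 0 then x else `|u n|^-1 *: u n.
have v1 n : `|v n| = 1.
  rewrite /v; case: ifPn => // un; rewrite normrZ normfV normr_id.
  by rewrite mulVf.
have uv n : `|u n - v n| = 1 - `|u n|.
  rewrite /v; case: ifPn => [un|un].
    rewrite (eqP un) subr0; move: un.
    by rewrite normr_eq0 => /eqP ->; rewrite sub0r normrN.
  rewrite -{1}(scale1r (u n)) -scalerBl normrZ ler0_norm; last first.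
    by rewrite subr_le0 invf_ge1 ?u1 // lt_neqAle eq_sym un normr_ge0.
  by rewrite opprB mulrBl mul1r mulVf.
have uv0 : 1 - `|u n| @[n --> \oo] --> (0 : R).
  by rewrite -[X in _ --> X](subrr (1 : R)); apply: cvgB => //; exact: cvg_cst.
have vc : `|v n - x| @[n --> \oo] --> (0 : R).
  apply: rot => // phi hphi.
  apply: (@squeeze_cvgr _ _ _ _ (fun n => `|x + \sum_(i < k) u (phi i n)| -
    \sum_(i < k) (1 - `|u (phi i n)|)) (cst k.+1%:R)).
  - apply: nearW => n; apply/andP; split; last first.
      by apply: norm_sum_le => // [|m]; rewrite ?x1 ?v1.
    rewrite lerBlDr.
    have -> : x + \sum_(i < k) u (phi i n) = (x + \sum_(i < k) v (phi i n)) +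
        \sum_(i < k) (u (phi i n) - v (phi i n)).
      by rewrite sumrB -addrA; congr (_ + _); rewrite addrC subrK.
    apply: le_trans (ler_normD _ _) _; rewrite lerD2l.
    apply: le_trans (ler_norm_sum _ _ _) _; apply: ler_sum => i _.
    by rewrite uv.
  - rewrite -[X in _ --> X]subr0; apply: cvgB; first exact: flat.
    apply: cvg_sum0 => i; exact: (cvg_subsequence (fun n => 1 - `|u n|)).
  - exact: cvg_cst.
apply: (@squeeze_cvgr _ _ _ _ (cst 0) (fun n => (1 - `|u n|) + `|v n - x|)).
- apply: nearW => n; rewrite normr_ge0 /= -uv.
  by apply: le_trans (ler_normD _ _); rewrite subrKA.
- exact: cvg_cst.
- by rewrite -[X in _ --> X]addr0; apply: cvgD.
Qed.

(** Let z_i = (1 - a) x + a u_i and c = 1 + k (1 - a). Then c (x + sum u_i) = (x + sum z_i) + (c -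
    a) sum u_i, and c (k + 1) - (c - a) k = k + 1, so the lower bound from the triangle inequality
    is sharp in the limit. *)
Lemma asymptotically_flat_convex k x u (a : R) : (0 < k)%N -> `|x| = 1 ->
  (forall n, `|u n| <= 1) -> 0 <= a <= 1 -> asymptotically_flat k x u ->
  asymptotically_flat k x (fun n => (1 - a) *: x + a *: u n).
Proof.
move=> k0 x1 u1 /andP[a0 a1] flat phi hphi.
pose c : R := 1 + k%:R * (1 - a).
have ca : 0 <= c - a by rewrite /c addrAC addr_ge0 ?mulr_ge0 ?subr_ge0.
have c0 : 0 <= c by rewrite addr_ge0 ?mulr_ge0 ?subr_ge0.
have zle n : `|(1 - a) *: x + a *: u n| <= 1.
  apply: le_trans (ler_normD _ _) _; rewrite !normrZ x1 mulr1.
  by rewrite !ger0_norm ?subr_ge0 //; have := u1 n; nra.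
apply: (@squeeze_cvgr _ _ _ _ (fun n =>
  c * `|x + \sum_(i < k) u (phi i n)| - (c - a) * k%:R) (cst k.+1%:R)).
- apply: nearW => n; apply/andP; split; last first.
    by apply: (norm_sum_le _ _ (fun n => (1 - a) *: x + a *: u n)); rewrite ?x1.
  rewrite lerBlDr -[X in X * `|_|](ger0_norm c0) -normrZ.
  have -> : c *: (x + \sum_(i < k) u (phi i n)) =
     (x + \sum_(i < k) ((1 - a) *: x + a *: u (phi i n))) +
     (c - a) *: \sum_(i < k) u (phi i n).
    rewrite big_split /= sumr_const card_ord -scaler_sumr scalerDr.
    rewrite [(c - a) *: _]scalerBl [x + _]addrA -[RHS]addrA subrKC; congr (_ + _).
    by rewrite -[X in _ = _ + X]scaler_nat [in RHS]scalerA /c [LHS]scalerDl scale1r.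
  apply: le_trans (ler_normD _ _) _; rewrite lerD2l normrZ ger0_norm //.
  rewrite ler_wpM2l //; apply: le_trans (ler_norm_sum _ _ _) _.
  apply: (@le_trans _ _ (\sum_(i < k) 1)); first exact: ler_sum.
  by rewrite sumr_const card_ord.
- have lim1 : c * k.+1%:R - (c - a) * k%:R = k.+1%:R :> R.
    by rewrite /c -natr1; ring.
  have := cvgB (cvgM (cvg_cst c) (flat _ hphi)) (cvg_cst ((c - a) * k%:R : R)).
  by rewrite lim1; apply.
- exact: cvg_cst.
Qed.

End rotundity.

(** [T] carries test sequences at [x] to test sequences at [T x]. As [T] need not be onto, rotundity
    only passes back in this way, not forward. *)
Lemma locally_fully_rotund_isometry {R : realType} {E F : normedModType R}
    (T : E -> F) k x : (forall y z, T (y + z) = T y + T z) ->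
  (forall y, `|T y| = `|y|) ->
  locally_fully_rotund_at k (T x) -> locally_fully_rotund_at k x.
Proof.
move=> TD Tn [Tx1 rot]; split; first by rewrite -Tn.
move=> u u1 flat.
have T0 : T 0 = 0.
  by apply: (addrI (T 0)); rewrite -TD !addr0.
have TB y z : T (y - z) = T y - T z.
  by apply: (addIr (T z)); rewrite -TD !subrK.
have Tsum (phi : 'I_k -> nat -> nat) n :
    T (\sum_(i < k) u (phi i n)) = \sum_(i < k) T (u (phi i n)).
  by apply: (big_morph T TD T0).
have -> : (fun n => `|u n - x|) = (fun n => `|T (u n) - T x|).
  by apply/funext => n; rewrite -TB Tn.
apply: rot => [n|phi hphi]; first by rewrite Tn.
have -> : (fun n => `|T x + \sum_(i < k) T (u (phi i n))|) =
    (fun n => `|x + \sum_(i < k) u (phi i n)|).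
  by apply/funext => n; rewrite -Tsum -TD Tn.
exact: flat.
Qed.

(** * Rotundity in function spaces and order continuity *)

Section function_space_rotundity.
Context {R : realType} {I : set R}.
Hypothesis mI : measurable I.
Context {E : banach_function_space I}.
Implicit Types (x y : E).

Lemma rrep_abs y : exists z : E,
  {ae mu, forall t, I t -> rrep z t = `|rrep y t|} /\ `|z| = `|y|.
Proof.
have [||z [zy zn]] := rrep_ideal (fun t => `|rrep y t|) y.
- by apply: (measurableT_comp (@normr_measurable R setT)); exact: measurable_rrep.
- by apply: aeW => t _; rewrite normr_id.
exists z; split=> //; apply: eq_norm_rrep; apply: aeS zy => t zyt It.
by rewrite zyt // normr_id.
Qed.

Lemma rrepD_sum (k : nat) x (u : 'I_k -> E) :
  {ae mu, forall t, I t ->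
    rrep (x + \sum_(i < k) u i) t = rrep x t + \sum_(i < k) rrep (u i) t}.
Proof.
apply: aeS2 (rrepD x (\sum_(i < k) u i)) (rrep_sum _ (index_enum 'I_k) u).
by move=> t xut ut It; rewrite xut // ut.
Qed.

(* Apply the hypothesis to [|u n|] and to [|x + u n| / 2], and use
   [|u - x| <= 2 ||u| - x| + 2 ||x + u| / 2 - x|], which holds if [x >= 0]. *)
Lemma locally_fully_rotund_nonneg k x : (0 < k)%N -> `|x| = 1 ->
  {ae mu, forall t, I t -> 0 <= rrep x t} ->
  (forall u : nat -> E, (forall n, {ae mu, forall t, I t -> 0 <= rrep (u n) t}) ->
    (forall n, `|u n| <= 1) -> asymptotically_flat k x u ->
    `|u n - x| @[n --> \oo] --> (0 : R)) ->
  locally_fully_rotund_at k x.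
Proof.
move=> k0 x1 x0 rot; split=> // u u1 flat.
have u1' n : `|u n| <= 1 by rewrite u1.
(* Both nonnegative sequences at once: [a = 1] gives the absolute values and [a = 1/2] those of the
   midpoints. Flatness survives absolute values because [x >= 0]. *)
have key (a : R) : 0 <= a <= 1 -> exists z : nat -> E,
    (forall n, {ae mu, forall t, I t -> rrep (z n) t =
       `|(1 - a) * rrep x t + a * rrep (u n) t|}) /\
    `|z n - x| @[n --> \oo] --> (0 : R).
  move=> /[dup] a01 /andP[a0 a1].
  pose m n := (1 - a) *: x + a *: u n.
  have mE n : {ae mu, forall t, I t ->
      rrep (m n) t = (1 - a) * rrep x t + a * rrep (u n) t}.
    apply: aeS3 (rrepD ((1 - a) *: x) (a *: u n)) (rrepZ (1 - a) x) (rrepZ a (u n)).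
    by move=> t mt xt ut It; rewrite mt // xt // ut.
  have /choice[z zP] n := rrep_abs (m n).
  have m1 n : `|m n| <= 1.
    apply: le_trans (ler_normD _ _) _; rewrite !normrZ x1 u1.
    by rewrite !ger0_norm ?subr_ge0 //; lra.
  exists z; split.
    move=> n; apply: aeS2 (zP n).1 (mE n) => t zt mt It.
    by rewrite zt // mt.
  have z0 n : {ae mu, forall t, I t -> 0 <= rrep (z n) t}.
    by apply: aeS (zP n).1 => t zt It; rewrite zt.
  apply: rot => //; first by move=> n; rewrite (zP n).2.
  move=> phi hphi.
  apply: (@squeeze_cvgr _ _ _ _ (fun n => `|x + \sum_(i < k) m (phi i n)|)
    (cst k.+1%:R)).
  - apply: nearW => n; apply/andP; split; last first.
      by apply: (norm_sum_le _ x z) => [|j]; rewrite ?x1 ?(zP _).2.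
    apply: le_norm_rrep.
    have zm : {ae mu, forall t, forall i : 'I_k, I t ->
        rrep (z (phi i n)) t = `|rrep (m (phi i n)) t|}.
      by apply: ae_forall_count => i; exact: (zP _).1.
    have zmx : {ae mu, forall t, I t -> 0 <= rrep x t /\ forall i : 'I_k,
        rrep (z (phi i n)) t = `|rrep (m (phi i n)) t|}.
      by apply: aeS2 zm x0 => t zmt xt It; split=> [|i]; [exact: xt|exact: zmt].
    apply: aeS3 (rrepD_sum k x (fun i => m (phi i n)))
      (rrepD_sum k x (fun i => z (phi i n))) zmx => t mt zt zmt It.
    have [xt {}zmt] := zmt It; rewrite mt // zt //.
    rewrite [leRHS]ger0_norm; last first.
      by apply: addr_ge0 => //; apply: sumr_ge0 => i _; rewrite zmt.
    apply: le_trans (ler_normD _ _) _; rewrite ger0_norm // lerD2l.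
    apply: le_trans (ler_norm_sum _ _ _) _; apply: ler_sum => i _.
    by rewrite zmt.
  - exact: (asymptotically_flat_convex _ _ _ _ k0 x1 u1' a01 flat).
  - exact: cvg_cst.
have [z1 [z1E z1x]] : exists z : nat -> E,
    (forall n, {ae mu, forall t, I t -> rrep (z n) t = `|rrep (u n) t|}) /\
    `|z n - x| @[n --> \oo] --> (0 : R).
  have [|z [zE zx]] := key 1; first by rewrite ler01 lexx.
  exists z; split=> // n; apply: aeS (zE n) => t zt It.
  by rewrite zt // subrr mul0r add0r mul1r.
have [|z2 [z2E z2x]] := key (2^-1); first by lra.
have le n : `|u n - x| <= `|z1 n - x| * 2 + `|z2 n - x| * 2.
  have [p [pE pn]] := rrep_abs (z1 n - x); have [q [qE qn]] := rrep_abs (z2 n - x).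
  rewrite -pn -qn.
  have -> : `|p| * 2 + `|q| * 2 = `|2 *: p| + `|2 *: q|.
    by rewrite !normrZ (ger0_norm (ler0n _ _)) mulrC [X in _ + X]mulrC.
  apply: le_trans (ler_normD _ _).
  apply: le_norm_rrep.
  have pq : {ae mu, forall t, I t -> rrep (2 *: p + 2 *: q) t =
      2 * `|(`|rrep (u n) t|) - rrep x t| +
      2 * `|(`|(1 - 2^-1) * rrep x t + 2^-1 * rrep (u n) t|) - rrep x t|}.
    have e1 : {ae mu, forall t, I t -> rrep (2 *: p) t =
        2 * `|(`|rrep (u n) t|) - rrep x t|}.
      have zx : {ae mu, forall t, I t ->
          rrep (z1 n - x) t = `|rrep (u n) t| - rrep x t}.
        by apply: aeS2 (rrepB (z1 n) x) (z1E n) => t zxt zt It;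
          rewrite zxt // zt.
      apply: aeS3 (rrepZ 2 p) pE zx => t pt pEt zxt It.
      by rewrite pt // pEt // zxt.
    have e2 : {ae mu, forall t, I t -> rrep (2 *: q) t =
       2 * `|(`|(1 - 2^-1) * rrep x t + 2^-1 * rrep (u n) t|) - rrep x t|}.
      have zx : {ae mu, forall t, I t -> rrep (z2 n - x) t =
          `|(1 - 2^-1) * rrep x t + 2^-1 * rrep (u n) t| - rrep x t}.
        by apply: aeS2 (rrepB (z2 n) x) (z2E n) => t zxt zt It;
          rewrite zxt // zt.
      apply: aeS3 (rrepZ 2 q) qE zx => t pt pEt zxt It.
      by rewrite pt // pEt // zxt.
    apply: aeS3 (rrepD (2 *: p) (2 *: q)) e1 e2 => t pqt pt qt It.
    by rewrite pqt // pt // qt.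
  apply: aeS3 (rrepB (u n) x) pq x0 => t uxt pqt xt It.
  rewrite uxt // pqt //; have := xt It.
  move: (rrep x t) (rrep (u n) t) => a b a0.
  rewrite [leRHS]ger0_norm ?addr_ge0 ?mulr_ge0 //.
  (* For [b >= 0] the first term alone suffices. For [b < 0] the second alone equals [a - b] if
     [a + b >= 0]; otherwise both are needed. *)
  have [b0|b0] := leP 0 b.
    have := normr_ge0 (`|2^-1 * a + 2^-1 * b| - a); have := normr_ge0 (b - a).
    rewrite (ger0_norm b0); set c := (1 - _) * a + _.
    by have := normr_ge0 (`|c| - a); lra.
  rewrite (ltr0_norm b0) (ltr0_norm (x := b - a)); last lra.
  rewrite (_ : (1 - 2^-1) * a + 2^-1 * b = 2^-1 * (a + b)); last lra.
  rewrite normrM ger0_norm; last lra.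
  have [ab|ab] := leP 0 (a + b).
    rewrite (ger0_norm ab) (ler0_norm (x := - b - a)); last lra.
    by rewrite ler0_norm; lra.
  rewrite (ltr0_norm ab) (gtr0_norm (x := - b - a)); last lra.
  have := ler_norm (- (2^-1 * - (a + b) - a)); rewrite normrN; lra.
apply: (@squeeze_cvgr _ _ _ _ (cst 0)
  (fun n => `|z1 n - x| * 2 + `|z2 n - x| * 2)).
- by apply: nearW => n; rewrite normr_ge0 le.
- exact: cvg_cst.
- have := cvgD (cvgM z1x (cvg_cst (2 : R))) (cvgM z2x (cvg_cst (2 : R))).
  by rewrite !mul0r addr0; apply.
Qed.

Hypothesis hsym : symmetric_space E.
Hypothesis hfatou : fatou_property E.

(** Increasing minorants [v n] of [u n] have norms tending to 1 by the Fatou property. A subsequence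
    index is at least [n], so [x] plus any [k] terms dominates [k.+1] times [v n]; hence [v] tests
    rotundity and tends to [x], and [u n] lies between [v n] and [x]. *)
Lemma locally_fully_rotund_order_continuous k x (u : nat -> E) : (0 < k)%N ->
  locally_fully_rotund_at k x -> {ae mu, forall t, I t -> 0 <= rrep x t} ->
  (forall n, {ae mu, forall t, I t -> 0 <= rrep (u n) t <= rrep x t}) ->
  {ae mu, forall t, I t -> rrep (u n) t @[n --> \oo] --> rrep x t} ->
  `|u n - x| @[n --> \oo] --> (0 : R).
Proof.
move=> k0 rot x0 ux uc; have [x1 _] := rot.
have un n : `|u n| <= `|x|.
  apply: le_norm_rrep; apply: aeS (ux n) => t uxt It.
  by have /andP[u0t uxt'] := uxt It; rewrite !ger0_norm // (le_trans u0t).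
have [|||v [x' [vu vi x'x _ vc]]] := fatou_minorants hfatou u (rrep x) `|x|.
- exact: measurable_rrep.
- exact: un.
- by apply: aeS uc => t uct It; apply: cvg_norm; exact: uct.
have {}x'x : x' = x.
  apply: rrep_inj; apply: aeS2 x'x x0 => t x'xt x0t It.
  by rewrite x'xt // ger0_norm // x0t.
rewrite x'x in vc.
have vux n : {ae mu, forall t, I t ->
    [/\ 0 <= rrep (v n) t, rrep (v n) t <= rrep (u n) t &
        rrep (u n) t <= rrep x t]}.
  apply: aeS2 (vu n) (ux n) => t vut uxt It.
  have /andP[v0 vu'] := vut It; have /andP[u0 ux'] := uxt It.
  by split=> //; rewrite -(ger0_norm u0).
have vmono m n : (m <= n)%N ->
    {ae mu, forall t, I t -> rrep (v m) t <= rrep (v n) t}.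
  elim: n => [|n IH]; first by rewrite leqn0 => /eqP ->; exact: aeW.
  rewrite leq_eqVlt => /orP[/eqP ->|]; first exact: aeW.
  rewrite ltnS => /IH {}IH; apply: aeS2 IH (vi n) => t mn nSn It.
  by apply: le_trans (mn It) (nSn It).
have v1 n : `|v n| <= 1.
  rewrite -x1; apply: le_norm_rrep; apply: aeS (vux n) => t vt It.
  have [v0 vu' ux'] := vt It.
  by rewrite !ger0_norm // ?(le_trans v0) // ?(le_trans vu') // (le_trans v0).
have vx : `|v n - x| @[n --> \oo] --> (0 : R).
  apply: locally_fully_rotund_le rot (v1) _ => // phi hphi.
  apply: (@squeeze_cvgr _ _ _ _ (fun n => k.+1%:R * `|v n|) (cst k.+1%:R)).
  - apply: nearW => n; apply/andP; split; last first.
      by apply: (norm_sum_le _ x v); [rewrite x1|exact: v1].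
    rewrite -[k.+1%:R]ger0_norm // -normrZ; apply: le_norm_rrep.
    have vphi : {ae mu, forall t, forall i : 'I_k, I t ->
        rrep (v n) t <= rrep (v (phi i n)) t}.
      by apply: ae_forall_count => i; apply: vmono; exact: leq_homo.
    have vphix : {ae mu, forall t, I t -> [/\ 0 <= rrep (v n) t,
        rrep (v n) t <= rrep x t &
        forall i : 'I_k, rrep (v n) t <= rrep (v (phi i n)) t]}.
      apply: aeS2 vphi (vux n) => t vphit vuxt It.
      have [v0 vu' ux'] := vuxt It.
      by split=> // [|i]; [exact: le_trans ux'|exact: vphit].
    apply: aeS3 (rrepZ k.+1%:R (v n)) (rrepD_sum k x (fun i => v (phi i n))) vphix.
    move=> t vZ vS vphit It; rewrite vZ // vS //.
    have [v0 vx vphit'] := vphit It.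
    rewrite ger0_norm ?mulr_ge0 // ger0_norm; last first.
      apply: addr_ge0; first exact: le_trans vx.
      by apply: sumr_ge0 => i _; exact: le_trans (vphit' i).
    rewrite -nat1r mulrDl mul1r lerD // mulr_natl.
    apply: (@le_trans _ _ (\sum_(i < k) rrep (v n) t)); last exact: ler_sum.
    by rewrite sumr_const card_ord.
  - have := cvgM (cvg_cst (k.+1%:R : R)) vc.
    by rewrite x1 mulr1; apply.
  - exact: cvg_cst.
apply: (@squeeze_cvgr _ _ _ _ (cst 0) (fun n => `|v n - x|)) => //; last first.
  exact: cvg_cst.
apply: nearW => n; rewrite normr_ge0 /=; apply: le_norm_rrep.
apply: aeS3 (rrepB (u n) x) (rrepB (v n) x) (vux n) => t uxt vxt vt It.
have [v0 vu' ux'] := vt It; rewrite uxt // vxt // !ler0_norm; lra.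
Qed.

Hypothesis I0 : I `<=` [set t | 0 <= t].

(** Otherwise the part [S n] of the superlevel set beyond [n] has infinite measure for every [n].
    The functions [l * \1_(S n)] are then equimeasurable, so they have one common nonzero norm; but
    they are dominated by the tails of [x], whose norms tend to 0 by order continuity. *)
Lemma locally_fully_rotund_distribution_fin k x l : (0 < k)%N ->
  locally_fully_rotund_at k x -> {ae mu, forall t, I t -> 0 <= rrep x t} ->
  0 < l -> (mu [set s | I s /\ (l < `|rrep x s|)%R] < +oo)%E.
Proof.
move=> k0 rot x0 l0; rewrite ltey; apply/eqP => dxoo.
pose S n := [set s | (I s /\ l < `|rrep x s|) /\ n%:R <= s].
have mItv n : measurable [set s : R | n%:R <= s].
  rewrite (_ : [set s | _] = `[n%:R, +oo[%classic); first exact: measurable_itv.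
  by apply/seteqP; split=> s /=; rewrite in_itv /= andbT.
have mx : measurable [set s | I s /\ l < `|rrep x s|].
  exact: measurable_gt_abs (measurable_rrep x).
have mS n : measurable (S n) by exact: (measurableI _ _ mx (mItv n)).
have muS n : mu (S n) = +oo%E.
  apply/eqP; rewrite -leye_eq -dxoo.
  pose J : set R := `[0, n%:R]%classic.
  have muJ : (mu J < +oo)%E.
    by rewrite lebesgue_measure_itv /=; case: ifP; rewrite -?EFinB ?ltry.
  rewrite leNgt; apply/negP => Sfin.
  have : (mu (S n `|` J) < +oo)%E.
    apply: (@le_lt_trans _ _ (mu (S n) + mu J)%E).
      by apply: measureU2; [exact: mS|exact: measurable_itv].
    by apply: lte_add_pinfty => //; rewrite -dxoo.
  rewrite ltNge => /negP; apply; rewrite -dxoo.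
  apply: le_lebesgue => //.
    by apply: measurableU => //; exact: measurable_itv.
  move=> s [Is ls]; have [ns|sn] := leP n%:R s; first by left.
  by right; rewrite /J /= in_itv /= (ltW sn) andbT; exact: I0.
have SnE n r : 0 <= r -> mu [set s | I s /\ r < `|l * \1_(S n) s|] =
    if r < l then +oo%E else 0.
  move=> r0; case: ifPn => rl.
    rewrite -(muS n); congr (mu _); apply/seteqP; split=> s /=.
      move=> [Is]; rewrite indicE; have [Ss|nSs] := pselect (S n s); first by [].
      by rewrite memNset // mulr0 normr0 ltNge r0.
    move=> Ss; split; first by case: Ss => -[].
    by rewrite indicE mem_set // mulr1 gtr0_norm.
  rewrite (_ : [set s | _] = set0) ?measure0 // -subset0 => s [Is].
  rewrite indicE -leNgt in rl *; case: (_ \in _); rewrite ?mulr1 ?mulr0 ?normr0.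
    by rewrite gtr0_norm // ltNge rl.
  by rewrite ltNge r0.
have mw n : measurable_fun I (fun s => l * \1_(S n) s).
  apply: measurable_funM; first exact: measurable_cst.
  exact: measurable_funTS (measurable_indic _).
have wP n : exists w : E, {ae mu, forall t, I t -> rrep w t = l * \1_(S n) t}.
  have [|w [wS _]] := rrep_ideal (fun s => l * \1_(S n) s) x (mw n).
    apply: aeW => t It; rewrite indicE; have [Ss|nS] := pselect (S n t).
      by rewrite mem_set // mulr1 gtr0_norm //; case: Ss => -[_ /ltW].
    by rewrite memNset // mulr0 normr0.
  by exists w.
have /choice[w {}wP] := wP.
have wn n : `|w n| = `|w 0%N|.
  have wE m r : 0 <= r -> mu [set s | I s /\ r < `|rrep (w m) s|] =
      if r < l then +oo%E else 0.
    move=> r0; rewrite -(SnE m) //; apply: ae_eq_measure.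
    - exact: measurable_gt_abs (measurable_rrep _).
    - exact: measurable_gt_abs (mw m).
    - by apply: aeS (wP m) => t wt; split=> -[It]; rewrite /= wt.
  by apply: (norm_equimeasurable mI hsym) => r r0; rewrite !wE.
have /choice[y yP] n : exists y : E,
    {ae mu, forall t, I t -> rrep y t = (t < n%:R)%R%:R * rrep x t}.
  have [||y [yE _]] := rrep_ideal (fun t => (t < n%:R)%R%:R * rrep x t) x.
  - have indE (t : R) : (t < n%:R)%R%:R = \1_(~` [set s : R | n%:R <= s]) t :> R.
      rewrite indicE in_setC; have [nt|tn] := leP n%:R t.
        by rewrite mem_set.
      by rewrite memNset //= leNgt tn.
    under eq_fun do rewrite indE.
    apply: measurable_funM; last exact: measurable_rrep.
    exact: measurable_funTS (measurable_indic (measurableC (mItv n))).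
  - apply: aeW => t It; rewrite normrM ger0_norm // ler_piMl //.
    by case: (_ < _).
  by exists y.
have yc : `|y n - x| @[n --> \oo] --> (0 : R).
  apply: (locally_fully_rotund_order_continuous k) => //.
    move=> n; apply: aeS2 (yP n) x0 => t yt xt It; rewrite yt //.
    by have := xt It; case: (t < _); rewrite ?mul1r ?mul0r lexx ?andbT.
  have := ae_forall_count _ _ yP; apply: aeS => t yt It.
  apply: cvg_near_cst; exists (Num.bound t) => // n /= tn.
  rewrite yt // (lt_le_trans (archi_boundP (I0 _ It))) ?mul1r //.
  by rewrite ler_nat.
have wy n : `|w 0%N| <= `|y n - x|.
  rewrite -(wn n); apply: le_norm_rrep.
  apply: aeS3 (wP n) (rrepB (y n) x) (yP n) => t wt yxt yt It.
  rewrite wt // yxt // yt // indicE.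
  have [Ss|nS] := pselect (S n t); last by rewrite memNset // mulr0 normr0.
  rewrite mem_set // mulr1 gtr0_norm //.
  case: Ss => -[_ lx]; rewrite leNgt => /negbTE ->.
  by rewrite mul0r sub0r normrN ltW.
have w0 : w 0%N = 0.
  apply/normr0_eq0/eqP; rewrite eq_le normr_ge0 andbT.
  rewrite -(cvg_lim _ yc) //; apply: limr_ge; first by apply/cvg_ex; exists 0.
  exact: nearW.
have : mu (S 0%N) = 0.
  rewrite -(measure0 (@lebesgue_measure R)); apply: ae_eq_measure => //.
  apply: aeS2 (wP 0%N) (rrep0 (E := E)) => t wt zt; split=> // St.
  have It : I t by case: St => -[].
  have := wt It; rewrite w0 zt // indicE mem_set // mulr1 => /esym/eqP.
  by rewrite gt_eqF.
by rewrite muS.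
Qed.

End function_space_rotundity.

(** * The isometry given by Ryff's theorem *)

Section symmetric_spaces.
Context {R : realType} {alpha : \bar R}.
Hypothesis alpha0 : (0 < alpha)%E.
Local Notation I := (interval_to alpha).
Context {E : banach_function_space I}.
Hypothesis hsym : symmetric_space E.
Hypothesis hfatou : fatou_property E.
Implicit Types x y : E.

Let mI : measurable I.
Proof. by apply: measurable_interval_to; exact: ltW. Qed.

Let I0 : I `<=` [set t | 0 <= t]. Proof. by move=> t []. Qed.

Definition abs_rrep x t := `|rrep x t|.

Lemma measurable_abs_rrep x : measurable_fun I (abs_rrep x).
Proof.
by apply: (measurableT_comp (@normr_measurable R setT)); exact: measurable_rrep.
Qed.

Lemma d_abs_rrep x l : d_ I (EFin \o abs_rrep x) l = d_ I (rep x) l.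
Proof.
rewrite d_rrep //; congr (mu _).
by apply/seteqP; split=> s /= -[Is]; rewrite normr_id lte_fin.
Qed.

Lemma rearr_abs_rrep x : rearr I (EFin \o abs_rrep x) = rearr I (rep x).
Proof.
apply/funext => t; congr (ereal_inf _); apply/seteqP; split=> _ [l [l0 lt] <-];
  by exists l => //; split=> //; move: lt; rewrite d_abs_rrep.
Qed.

Lemma rep_rearr x : exists y, ae_eq mu I (rep y) (rearr I (rep x)) /\
  `|y| = `|x|.
Proof.
apply: hsym; last by move=> l l0; rewrite d_rearr //; [exact: ltW|exact: rep_measurable].
apply: measurable_funTS; apply: measurable_rearr => //.
exact: rep_measurable.
Qed.

(* Composition with a map [sigma] such that [|x| = x^* \o sigma]. *)
Lemma rearr_isometry x y z :
  (forall l, 0 < l -> (d_ I (rep x) l < +oo)%E) ->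
  ae_eq mu I (rep y) (rearr I (rep x)) ->
  ae_eq mu I (rep z) (fun t => `|rep x t|%E) ->
  exists T : E -> E, [/\ forall v w, T (v + w) = T v + T w,
    forall v, `|T v| = `|v| & T y = z].
Proof.
move=> dfin yx zx.
have [V [sigma [[mV VI] [msigma sigmaI] push uV uNV]]] :
  exists (V : set R) (sigma : R -> R), [/\
    measurable V /\ V `<=` I, measurable_fun setT sigma /\
      (forall s, V s -> I (sigma s)),
    forall B, measurable B -> mu (sigma @^-1` B `&` V) = mu (B `&` I),
    {ae mu, forall s, V s ->
      rearr I (EFin \o abs_rrep x) (sigma s) = (abs_rrep x s)%:E} &
    {ae mu, forall s, I s -> ~ V s -> abs_rrep x s = 0}].
  apply: ryff => //; [exact: measurable_abs_rrep|by move=> s; exact: normr_ge0|].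
  by move=> l l0; rewrite d_abs_rrep dfin.
rewrite rearr_abs_rrep in uV.
(* Preimages of null sets under the measure preserving [sigma] are null, so a.e. statements can be
   composed with it. *)
have pull (Q : R -> Prop) : {ae mu, forall t, I t -> Q t} ->
    {ae mu, forall s, V s -> Q (sigma s)}.
  move=> [N [mN N0 NQ]]; exists (sigma @^-1` N `&` V); split.
  - apply: measurableI => //; rewrite -[_ @^-1` _]setTI; exact: msigma.
  - apply/eqP; rewrite eq_le measure_ge0 andbT push // -N0.
    by apply: le_lebesgue => //; exact: measurableI.
  - move=> s /= /not_implyP[Vs nQ]; split=> //; apply: NQ => /= H.
    by apply: nQ; apply: H; exact: sigmaI.
(* Restricting to [I] first makes the composite measurable on the whole line; the indicator extends
   it by 0 off [V], where [rep x] vanishes a.e. on [I]. *)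
pose C (v : E) (s : R) : R := ((rrep v \_ I) \o sigma) s * \1_V s.
have CE v s : V s -> C v s = rrep v (sigma s).
  move=> Vs; rewrite /C /= patchE mem_set; last exact: sigmaI.
  by rewrite indicE mem_set // mulr1.
have CN v s : ~ V s -> C v s = 0.
  by move=> Vs; rewrite /C indicE memNset ?mulr0.
have mC v : measurable_fun setT (C v).
  apply: measurable_funM; last exact: measurable_indic.
  apply: measurableT_comp => //.
  apply/(measurable_restrict _ mI measurableT).
  by rewrite setTI; exact: measurable_rrep.
have /choice[T TP] v : exists w : E,
    {ae mu, forall t, I t -> rrep w t = C v t} /\ `|w| = `|v|.
  apply: (rrep_equimeasurable mI hsym); first exact: measurable_funTS.
  move=> l l0; pose B := [set s | I s /\ l < `|rrep v s|].
  have mB : measurable B by exact: measurable_gt_abs (measurable_rrep v).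
  transitivity (mu (B `&` I)); last first.
    by congr (mu _); apply/seteqP; split=> s [] // Is lv; split.
  rewrite -push //; congr (mu _); apply/seteqP; split=> s /=.
    move=> [Is]; have [Vs|nV] := pselect (V s).
      by rewrite CE // => lv; split=> //; split=> //; exact: sigmaI.
    by rewrite CN // normr0 ltNge l0.
  by move=> [[Is lv] Vs]; split; [exact: VI|rewrite CE].
exists T; split.
- move=> v w; apply: rrep_inj.
  have TS : {ae mu, forall t, I t ->
      rrep (T v + T w) t = C v t + C w t}.
    apply: aeS3 (rrepD (T v) (T w)) (TP v).1 (TP w).1 => t Tt Tv Tw It.
    by rewrite Tt // Tv // Tw.
  apply: aeS3 TS (TP (v + w)).1 (pull _ (rrepD v w)) => t Tt Tvw vw It.
  rewrite Tt // Tvw //; have [Vt|nV] := pselect (V t).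
    by rewrite !CE // vw.
  by rewrite !CN // addr0.
- by move=> v; exact: (TP v).2.
- apply: rrep_inj.
  have zE : {ae mu, forall t, I t -> rrep z t = abs_rrep x t}.
    apply: ae_eq_rrep; apply: aeS2 zx (rrepE x) => t zt xt It.
    by rewrite zt // xt.
  have {}yx : {ae mu, forall t, I t -> rrep y t = fine (rearr I (rep x) t)}.
    by apply: aeS yx => t yt It; rewrite /rrep yt.
  have yV : {ae mu, forall s, V s -> rrep y (sigma s) = abs_rrep x s}.
    by apply: aeS2 uV (pull _ yx) => s us ys Vs; rewrite ys // us.
  have Cy : {ae mu, forall t, I t -> C y t = abs_rrep x t}.
    apply: aeS2 yV uNV => t yt ut It; have [Vt|nV] := pselect (V t).
      by rewrite CE // yt.
    by rewrite CN // ut.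
  apply: aeS3 (TP y).1 zE Cy => t Tt zt Ct It.
  by rewrite Tt // zt // Ct.
Qed.

End symmetric_spaces.

(** * Cells given by level sets *)

Lemma eq_of_lt {R : realType} (a b : \bar R) : (0 <= a)%E -> (0 <= b)%E ->
  (forall l : R, 0 <= l -> (l%:E < a)%E = (l%:E < b)%E) -> a = b.
Proof.
move=> a0 b0 ab; apply/eqP; rewrite eq_le; apply/andP; split.
  case: b b0 ab => [b| |] // b0 ab; last by rewrite leey.
  by rewrite leNgt ab // ltxx.
case: a a0 ab => [a| |] // a0 ab; last by rewrite leey.
by rewrite leNgt -ab // ltxx.
Qed.

Section level_cells.
Context {R : realType} {alpha : \bar R}.
Hypothesis alpha0 : (0 < alpha)%E.
Local Notation I := (interval_to alpha).
Variable u : R -> R.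
Hypothesis u_meas : measurable_fun I u.
Hypothesis u0 : forall s, 0 <= u s.
Local Notation d := (d_ I (EFin \o u)).
Local Notation ustar := (rearr I (EFin \o u)).
Hypothesis dfin : forall l, 0 < l -> (d l < +oo)%E.
Variables (delta : R) (N : nat).
Hypothesis delta0 : 0 < delta.

Let mI : measurable I.
Proof. by apply: measurable_interval_to; exact: ltW. Qed.

Let mEu : measurable_fun I (EFin \o u). Proof. exact/measurable_EFinP. Qed.

Definition level (s : R) : nat := lev delta N (u s).

(* Only the position of [ustar t] relative to [N%:R * delta] and below matters;
   the truncation makes the value finite even if [ustar 0 = +oo]. *)
Definition level_star (t : R) : nat :=
  lev delta N (fine (mine (ustar t) (N.+1%:R * delta)%:E)).

Definition superlevel (j : nat) : set R := [set s | I s /\ (j <= level s)%N].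

Definition level_cell (s : R) : 'I_N.+1 := inord (level s).
Definition level_star_cell (t : R) : 'I_N.+1 := inord (level_star t).
(** The rearrangement decreases, so its higher levels come first and take up exactly this length. *)
Definition cell_start (j : 'I_N.+1) : R := fine (mu (superlevel j.+1)).

Lemma superlevel0 : superlevel 0 = I.
Proof. by apply/seteqP; split=> s // []. Qed.

Lemma superlevel_gt j : (N < j)%N -> superlevel j = set0.
Proof.
move=> Nj; rewrite -subset0 => s [_ js].
by have := leq_trans js (lev_le _ _ _); rewrite leqNgt Nj.
Qed.

Lemma superlevelE j : (0 < j <= N)%N ->
  superlevel j = [set s | I s /\ ((j%:R * delta)%:E < `|(EFin \o u) s|)%E].
Proof.
move=> /andP[j0 jN]; rewrite /superlevel; apply/seteqP; split=> s /= [Is];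
by rewrite /level leq_lev // -leqn0 leqNgt j0 /= ger0_norm // lte_fin.
Qed.

Lemma measurable_superlevel j : measurable (superlevel j).
Proof.
have [->|j0] := posnP j; first by rewrite superlevel0.
have [jN|Nj] := leqP j N; last by rewrite superlevel_gt.
by rewrite superlevelE ?j0 //; exact: measurable_d.
Qed.

Lemma superlevel_fin j : (mu (superlevel j.+1) < +oo)%E.
Proof.
have [jN|Nj] := leqP j.+1 N; last by rewrite superlevel_gt // measure0.
by rewrite superlevelE // dfin // mulr_gt0.
Qed.

Lemma cell_startE j : (cell_start j)%:E = mu (superlevel j.+1).
Proof. by rewrite fineK // ge0_fin_numE // superlevel_fin. Qed.

Lemma le_superlevel j : superlevel j.+1 `<=` superlevel j.
Proof. by move=> s [Is js]; split=> //; exact: ltnW. Qed.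

Lemma leq_level_star j t : I t /\ (j <= level_star t)%N <->
  0 <= t /\ (t%:E < mu (superlevel j))%E.
Proof.
have [->|j0] := posnP j.
  rewrite superlevel0 measure_interval_to; last exact: ltW.
  by split=> [[It _]|It].
have [jN|Nj] := leqP j N; last first.
  rewrite superlevel_gt // measure0; split=> [[_ js]|[t0]].
    by have := leq_trans js (lev_le _ _ _); rewrite leqNgt Nj.
  by rewrite lte_fin ltNge t0.
have starE : (j <= level_star t)%N = (t%:E < mu (superlevel j))%E.
  rewrite superlevelE ?j0 // /level_star leq_lev // -leqn0 leqNgt j0 /= -lte_fin fineK.
    have jd0 : 0 <= j%:R * delta by rewrite mulr_ge0 // ltW.
    by rewrite lt_min lte_fin ltr_pM2r // ltr_nat ltnS jN andbT lt_rearr.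
  rewrite ge0_fin_numE; first by rewrite gt_min ltry orbT.
  by rewrite le_min rearr_ge0 lee_fin mulr_ge0 // ltW.
rewrite starE; split=> [[[t0 _]]|[t0 tj]] //; split=> //; split=> //.
apply: lt_le_trans tj _; rewrite -[leRHS]measure_interval_to; last exact: ltW.
by apply: le_lebesgue => //; [exact: measurable_superlevel|move=> s []].
Qed.

Lemma level_cellE (j : 'I_N.+1) : [set s | I s /\ level_cell s = j] =
  superlevel j `\` superlevel j.+1.
Proof.
apply/seteqP; split=> s.
  move=> [Is <-]; rewrite /level_cell inordK ?ltnS ?lev_le //.
  by split=> // -[_]; rewrite ltnn.
move=> [[Is js] njs]; split=> //; apply/val_inj.
rewrite /= inordK ?ltnS ?lev_le //; apply/eqP; rewrite eqn_leq js andbT leqNgt.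
by apply/negP => j's; apply: njs.
Qed.

Lemma measurable_level_cell (j : 'I_N.+1) : measurable [set s | I s /\ level_cell s = j].
Proof. by rewrite level_cellE; apply: measurableD; exact: measurable_superlevel. Qed.

Lemma measure_superlevel (j : 'I_N.+1) : mu (superlevel j) =
  (mu [set s | I s /\ level_cell s = j] + mu (superlevel j.+1))%E.
Proof.
rewrite level_cellE -lebesgueU.
- by rewrite setUC setDUK //; exact: le_superlevel.
- by apply: measurableD; exact: measurable_superlevel.
- exact: measurable_superlevel.
- by rewrite -subset0 => s [[_ ns] s']; apply: ns.
Qed.

Lemma lt_cell_start (t : R) (c : \bar R) (j : 'I_N.+1) :
  (t%:E < c + mu (superlevel j.+1))%E = ((t - cell_start j)%:E < c)%E.
Proof. by rewrite -cell_startE EFinB lteBlDr. Qed.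

(** The hypothesis [lab'P] of the cellwise rearrangement: a target cell is the difference of two
    consecutive initial intervals, whose lengths are the measures of the superlevel sets. *)
Lemma level_star_cellP j t : I t /\ level_star_cell t = j <->
  cell_start j <= t /\
  ((t - cell_start j)%:E < mu [set s | I s /\ level_cell s = j])%E.
Proof.
have b0 : 0 <= cell_start j by rewrite fine_ge0.
have starP : level_star_cell t = j <->
    (j <= level_star t)%N /\ ~ (j.+1 <= level_star t)%N.
  split=> [<-|[js njs]].
    by rewrite /level_star_cell inordK ?ltnS ?lev_le // ltnn.
  apply/val_inj; rewrite /= inordK ?ltnS ?lev_le //; apply/eqP.
  by rewrite eqn_leq js andbT leqNgt; exact/negP.
rewrite -lt_cell_start -measure_superlevel; split.
  move=> [It /starP[js njs]]; have [t0 tj] := (leq_level_star j t).1 (conj It js).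
  split=> //; rewrite -lee_fin cell_startE leNgt; apply/negP => tj1.
  by have [] := (leq_level_star j.+1 t).2 (conj t0 tj1).
move=> [bt tj]; have t0 : 0 <= t by apply: le_trans bt.
have [It js] := (leq_level_star j t).2 (conj t0 tj); split=> //.
apply/starP; split=> // js1.
have [_] := (leq_level_star j.+1 t).1 (conj It js1).
by rewrite -cell_startE lte_fin ltNge bt.
Qed.

(* Within a cell, the rearrangement of [u] is its global rearrangement. *)
Lemma cell_rearr_level t : I t ->
  cell_rearr (I := I) level_cell level_star_cell cell_start u t = ustar t.
Proof.
move=> It; pose j := level_star_cell t.
have [bt tA] := (level_star_cellP j t).1 (conj It erefl).
have mA := measurable_level_cell.
have t1 : (mu (superlevel j.+1) <= t%:E)%E by rewrite -cell_startE lee_fin.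
have t2 : (t%:E < mu (superlevel j))%E.
  by rewrite measure_superlevel lt_cell_start.
have mU l : measurable [set s | I s /\ l < u s].
  have := measurable_gt_abs I u l mI u_meas.
  by congr measurable; apply/seteqP; split=> s /= -[Is]; rewrite ger0_norm.
have dE l : d l = mu [set s | I s /\ l < u s].
  by congr (mu _); apply/seteqP; split=> s /= -[Is]; rewrite ger0_norm // lte_fin.
have dAE l : d_ [set s | I s /\ level_cell s = j] (EFin \o u) l =
    mu ([set s | I s /\ level_cell s = j] `&` [set s | I s /\ l < u s]).
  congr (mu _); apply/seteqP; split=> s /=.
    by move=> [[Is sj]]; rewrite ger0_norm // lte_fin.
  by move=> [[Is sj] [_]]; rewrite ger0_norm // lte_fin.
have lt_eq l : 0 <= l -> (l%:E < cell_rearr (I := I) level_cell level_star_cell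
    cell_start u t)%E = (l%:E < ustar t)%E.
  move=> l0; rewrite (lt_cell_rearr mI) // lt_rearr // -/j dAE dE.
  (* Here [l] is at least all values in the cell, and both sides fail since [t] is not before the
     start of the cell. The top cell has no such upper bound, hence the condition on [j]. *)
  have [jl|jl] := boolP ((j.+1 <= N)%N && (j.+1%:R * delta <= l)).
    have [jN lj] := andP jl.
    have UP : [set s | I s /\ l < u s] `<=` superlevel j.+1.
      move=> s [Is ls]; split=> //; rewrite /level leq_lev // (le_lt_trans lj) ?orbT //.
    rewrite (_ : _ `&` _ = set0); last first.
      by rewrite -subset0 => s [+ /UP]; rewrite level_cellE => -[_].
    rewrite measure0 lte_fin ltNge subr_ge0 bt; apply/esym/negbTE.
    by rewrite -leNgt (le_trans _ t1) //; apply: le_lebesgue => //;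
      exact: measurable_superlevel.
  have PU : superlevel j.+1 `<=` [set s | I s /\ l < u s].
    move=> s [Is js]; split=> //.
    have jN : (j.+1 <= N)%N by apply: leq_trans js (lev_le _ _ _).
    move: js; rewrite /level leq_lev //= => ju; apply: lt_trans ju.
    by move: jl; rewrite jN /= -ltNge.
  (* Here [u > l] on the whole cell, and both sides hold since [t] is before its end. *)
  have [lj|lj] := boolP ((0 < j)%N && (l < j%:R * delta)).
    have [j0 lj'] := andP lj.
    have jN : (j <= N)%N by rewrite -ltnS.
    have QU : superlevel j `<=` [set s | I s /\ l < u s].
      move=> s [Is]; rewrite /level leq_lev // -leqn0 leqNgt j0 /= => ju.
      by split=> //; exact: lt_trans ju.
    rewrite setIidl; last first.
      by rewrite level_cellE => s [/QU].
    rewrite tA; apply/esym; apply: lt_le_trans t2 _.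
    by apply: le_lebesgue => //; exact: measurable_superlevel.
  have UQ : [set s | I s /\ l < u s] `<=` superlevel j.
    move=> s [Is ls]; split=> //; rewrite /level leq_lev //; last by rewrite -ltnS.
    move: lj; rewrite negb_and -leqNgt leqn0 -leNgt => /orP[->//|jl'].
    by rewrite (le_lt_trans jl') ?orbT.
  (* In between, the set where [u > l] is its part in the cell together with all higher cells, whose
     total measure is the shift [cell_start j]. *)
  rewrite -lt_cell_start -lebesgueU; last 3 first.
  - by apply: measurableI.
  - exact: measurable_superlevel.
  - by rewrite level_cellE -subset0 => s [[[_ ns] _] s']; apply: ns.
  congr (_ < mu _)%E; apply/seteqP; split=> s.
    by move=> [[]//|/PU].
  move=> Us; have [s1|s1] := pselect (superlevel j.+1 s); first by right.
  by left; split=> //; rewrite level_cellE; split=> //; exact: UQ.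
by apply: eq_of_lt => //; exact: rearr_ge0.
Qed.

End level_cells.

(** * Rotundity passes from x^* to |x| *)

Section rearrangement_rotundity.
Context {R : realType} {alpha : \bar R}.
Hypothesis alpha0 : (0 < alpha)%E.
Local Notation I := (interval_to alpha).
Context {E : banach_function_space I}.
Hypothesis hsym : symmetric_space E.
Hypothesis hfatou : fatou_property E.
Implicit Types x y z : E.

Let mI : measurable I.
Proof. by apply: measurable_interval_to; exact: ltW. Qed.

Let I0 : I `<=` [set t | 0 <= t]. Proof. by move=> t []. Qed.

Lemma lev_homo (delta : R) (M : nat) : 0 < delta ->
  {homo lev delta M : a b / a <= b >-> (a <= b)%N}.
Proof.
move=> d0 a b ab; rewrite leq_lev ?lev_le //.
have := leq_lev delta M a (lev delta M a) d0 (lev_le _ _ _).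
by rewrite leqnn => /esym/orP[->//|la]; rewrite (lt_le_trans la) ?orbT.
Qed.

(** The truncation in [level_star] is harmless because the cap lies strictly above the highest
    threshold [M%:R * delta]. *)
Lemma lev_min (delta : R) (M : nat) (a : R) : 0 < delta ->
  lev delta M (Num.min a (M.+1%:R * delta)) = lev delta M a.
Proof.
move=> d0; apply/eqP; rewrite eqn_leq lev_homo ?ge_min ?lexx //=.
rewrite leq_lev ?lev_le // lt_min ltr_pM2r // ltr_nat ltnS lev_le andbT.
by rewrite -(leq_lev delta M a _ d0) ?lev_le.
Qed.

Lemma measurable_lev (delta : R) (M : nat) (f : R -> R) (D : set R) : 0 < delta ->
  measurable_fun D f -> measurable_fun D (fun t => (lev delta M (f t))%:R : R).
Proof.
move=> d0 mf; apply: (measurableT_comp (f := fun a => (lev delta M a)%:R : R)) => //.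
apply: nondecreasing_measurable => // a b ab; rewrite ler_nat; exact: lev_homo.
Qed.

Lemma lev_cvg (y : R) : 0 <= y ->
  (lev m.+1%:R^-1 (m.+1 ^ 2)%N y)%:R * m.+1%:R^-1 @[m --> \oo] --> y.
Proof.
move=> y0; apply/cvgrPdist_le => e e0.
have [n1 _ n1P] := near_infty_natSinv_lt (PosNum e0).
near=> m.
have d0 : 0 < m.+1%:R^-1 :> R by rewrite invr_gt0.
have yb : y <= (Num.bound y)%:R by exact/ltW/archi_boundP.
have ub : y <= (m.+1 ^ 2)%:R / m.+1%:R.
  rewrite natrX expr2 mulfK //; apply: le_trans yb _; rewrite ler_nat.
  by apply: leqW; near: m; exact: nbhs_infty_ge.
have := lev_ub _ _ _ d0 ub; have lb := lev_lb _ (m.+1 ^ 2)%N _ d0 y0.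
rewrite ger0_norm ?subr_ge0 // -[(lev _ _ _).+1%:R]natr1 mulrDl mul1r -lerBlDl.
move=> /le_trans; apply; apply/ltW/n1P; near: m; exact: nbhs_infty_ge.
Unshelve. all: by end_near. Qed.

Lemma fully_rotund_of_rearr k x y z : (0 < k)%N ->
  ae_eq mu I (rep y) (rearr I (rep x)) ->
  ae_eq mu I (rep z) (fun t => `|rep x t|%E) ->
  locally_fully_rotund_at k y -> locally_fully_rotund_at k z.
Proof.
move=> k0 yx zx roty; have [y1 _] := roty.
pose u := abs_rrep x.
have u0 s : 0 <= u s by exact: normr_ge0.
have u_meas : measurable_fun I u by exact: measurable_abs_rrep.
rewrite -rearr_abs_rrep // -/u in yx.
have zu : {ae mu, forall t, I t -> rrep z t = u t}.
  apply: ae_eq_rrep; apply: aeS2 zx (rrepE x) => t zt xt It.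
  by rewrite zt // xt.
have y0 : {ae mu, forall t, I t -> 0 <= rrep y t}.
  by apply: aeS yx => t yt It; rewrite /rrep yt // fine_ge0 // rearr_ge0.
have yE : {ae mu, forall t, I t -> rearr I (EFin \o u) t = (rrep y t)%:E}.
  by apply: aeS2 yx (rrepE y) => t yt yt' It; rewrite -yt' // yt.
have dE l : 0 <= l -> mu [set s | I s /\ l < `|rrep y s|] = d_ I (EFin \o u) l.
  move=> l0; rewrite -(d_rrep mI) -[RHS](d_rearr alpha) //; last 2 first.
  - exact: ltW.
  - exact/measurable_EFinP.
  apply: ae_eq_measure.
  - by apply: measurable_d => //; exact: rep_measurable.
  - apply: measurable_d => //; apply: measurable_funTS.
    by apply: measurable_rearr => //; exact/measurable_EFinP.
  - by apply: aeS yx => t yt; split=> /= -[It]; rewrite yt.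
have dfin l : 0 < l -> (d_ I (EFin \o u) l < +oo)%E.
  move=> l0; rewrite -dE ?ltW //.
  exact: (locally_fully_rotund_distribution_fin mI hsym hfatou I0 k).
have z1 : `|z| = 1.
  rewrite -y1; apply: (norm_equimeasurable mI hsym) => l l0; rewrite dE //.
  apply: ae_eq_measure.
  - exact: measurable_gt_abs (measurable_rrep _).
  - by apply: measurable_d => //; exact/measurable_EFinP.
  - by apply: aeS zu => t zt; split=> /= -[It]; rewrite lte_fin zt.
apply: locally_fully_rotund_nonneg => //.
  by apply: aeS zu => t zt It; rewrite zt.
move=> v v0 v1 flat.
(* Roundings of x^* from below tend to it in norm by order continuity at [y]. They alone decide how
   fine the subdivision must be; the test sequence plays no part in this choice. *)
have /choice[yl ylP] (m : nat) : exists w : E, {ae mu, forall t, I t ->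
    rrep w t = (lev m.+1%:R^-1 (m.+1 ^ 2)%N (`|rrep y t|))%:R * m.+1%:R^-1}.
  have d0 : 0 < m.+1%:R^-1 :> R by rewrite invr_gt0.
  have [||w [wE _]] := rrep_ideal (fun t =>
    (lev m.+1%:R^-1 (m.+1 ^ 2)%N (`|rrep y t|))%:R * m.+1%:R^-1) y.
  - apply: measurable_funM; last exact: measurable_cst.
    by apply: measurable_lev => //; exact: measurable_abs_rrep.
  - apply: aeW => t It; rewrite ger0_norm ?lev_lb // mulr_ge0 // ltW.
  by exists w.
have ylc : `|yl m - y| @[m --> \oo] --> (0 : R).
  apply: (locally_fully_rotund_order_continuous hfatou k) => //.
    move=> m; apply: aeS2 (ylP m) y0 => t yt y0t It; rewrite yt //.
    by rewrite mulr_ge0 // -[leRHS]ger0_norm ?y0t // lev_lb // invr_gt0.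
  have := ae_forall_count _ _ ylP; apply: aeS2 y0 => t y0t yt It.
  rewrite -[X in _ --> X]ger0_norm ?y0t //.
  rewrite (_ : (fun m => rrep (yl m) t) = fun m =>
    (lev m.+1%:R^-1 (m.+1 ^ 2)%N (`|rrep y t|))%:R * m.+1%:R^-1).
    exact: lev_cvg.
  by apply/funext => m; rewrite yt.
apply/cvgrPdist_le => e e0.
have [m ylm] : exists m : nat, `|yl m - y| <= e / 3.
  have e3 : 0 < e / 3 by rewrite divr_gt0.
  have /cvgrPdist_le/(_ _ e3)[m _ /(_ m (leqnn m))] := ylc.
  by rewrite sub0r normrN normr_id; exists m.
pose delta : R := m.+1%:R^-1; pose M := (m.+1 ^ 2)%N.
have delta0 : 0 < delta by rewrite invr_gt0.
pose lab := level_cell u delta M.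
pose lab' := level_star_cell (alpha := alpha) u delta M.
pose b := cell_start (alpha := alpha) u delta M.
have mA : forall j, measurable [set s | I s /\ lab s = j].
  by move=> j; exact: measurable_level_cell.
have lab'P : forall j t, I t /\ lab' t = j <->
    b j <= t /\ ((t - b j)%:E < mu [set s | I s /\ lab s = j])%E.
  by move=> j t; exact: level_star_cellP.
have /choice[v' v'P] (n : nat) : exists w : E, {ae mu, forall t, I t ->
    cell_rearr (I := I) lab lab' b (abs_rrep (v n)) t = (rrep w t)%:E} /\
    `|w| = `|v n|.
  have mvn : measurable_fun I (abs_rrep (v n)) by exact: measurable_abs_rrep.
  have vn0 s : 0 <= abs_rrep (v n) s by exact: normr_ge0.
  have [||w [wE wn]] := hsym (cell_rearr (I := I) lab lab' b (abs_rrep (v n))) (v n).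
  - exact: measurable_cell_rearr.
  - by move=> l l0; rewrite d_cell_rearr // d_abs_rrep.
  - exists w; split=> //; apply: aeS2 wE (rrepE w) => t wt wt' It.
    by rewrite -wt' // wt.
pose w (j : 'I_M.+1) : R := j%:R * delta.
have [c cE] : exists c : E, {ae mu, forall t, I t -> rrep c t = w (lab t)}.
  have labE t : w (lab t) = (lev delta M (u t))%:R * delta.
    by rewrite /w /lab /level_cell inordK // ltnS lev_le.
  have [||c [cE _]] := rrep_ideal (fun t => w (lab t)) z.
  - under eq_fun do rewrite labE.
    by apply: measurable_funM; [exact: measurable_lev|exact: measurable_cst].
  - apply: aeS zu => t zt It; rewrite zt // labE !ger0_norm ?lev_lb //.
    by rewrite mulr_ge0 // ltW.
  by exists c.
(* So [yl m] is the step function [c] carried over to the target cells. *)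
have ylE : {ae mu, forall t, I t -> rrep (yl m) t = w (lab' t)}.
  apply: aeS3 (ylP m) yE y0 => t ylt yt y0t It; rewrite ylt //.
  rewrite /w /lab' /level_star_cell inordK ?ltnS ?lev_le //.
  rewrite /level_star yt // -EFin_min /= lev_min //.
  by rewrite ger0_norm // y0t.
have dist (f : R -> R) (p p' : E) : measurable_fun I f -> (forall s, 0 <= f s) ->
    {ae mu, forall t, I t -> rrep p t = f t} ->
    {ae mu, forall t, I t -> cell_rearr (I := I) lab lab' b f t = (rrep p' t)%:E} ->
    `|p - c| = `|p' - yl m|.
  move=> mf f0 pf fp'; apply: (norm_equimeasurable mI hsym) => l l0.
  have mwl : measurable_fun I (fun s => rrep p' s - w (lab' s)).
    apply: measurable_funB; first exact: measurable_rrep.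
    under eq_fun do rewrite /w /lab' /level_star_cell inordK ?ltnS ?lev_le //.
    apply: measurable_funM; last exact: measurable_cst.
    apply: measurable_lev => //; apply: measurable_funTS.
    apply: (measurableT_comp (@fine_measurable R setT _)) => //.
    apply: measurable_mine; last exact: measurable_cst.
    by apply: measurable_rearr => //; exact/measurable_EFinP.
  have mwl' : measurable_fun I (fun s => f s - w (lab s)).
    apply: measurable_funB => //.
    under eq_fun do rewrite /w /lab /level_cell inordK ?ltnS ?lev_le //.
    by apply: measurable_funM; [exact: measurable_lev|exact: measurable_cst].
  transitivity (mu [set s | I s /\ l < `|f s - w (lab s)|]).
    apply: ae_eq_measure.
    - exact: measurable_gt_abs (measurable_rrep _).
    - exact: (measurable_gt_abs I (fun s => f s - w (lab s))).
    - by apply: aeS3 (rrepB p c) pf cE => t pct pt ct; split=> /= -[It];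
        rewrite pct // pt // ct.
  transitivity (mu [set s | I s /\ l < `|rrep p' s - w (lab' s)|]).
    apply/esym; apply: cell_rearr_shift mf f0 _ _ (measurable_rrep p') fp' _ _ _ l0 => //.
    - by move=> j; rewrite mulr_ge0 // ltW.
    (* Only the lowest cell can have infinite measure, and its value is 0; the others lie in
       superlevel sets of finite measure. *)
    - move=> j; have [j0|j0] := posnP j; first by left; rewrite /w j0 mul0r.
      right; rewrite /lab level_cellE.
      apply: (@le_lt_trans _ _ (mu (superlevel (alpha := alpha) u delta M j))).
        apply: le_lebesgue => [||s []//]; last exact: measurable_superlevel.
        by apply: measurableD; exact: measurable_superlevel.
      by rewrite -(prednK j0); exact: superlevel_fin.
  apply: ae_eq_measure.
  - exact: (measurable_gt_abs I (fun s => rrep p' s - w (lab' s))).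
  - exact: measurable_gt_abs (measurable_rrep _).
  - by apply: aeS2 (rrepB p' (yl m)) ylE => t pct ct; split=> /= -[It];
      rewrite pct // ct.
have zc : `|z - c| = `|y - yl m|.
  apply: (dist u) => //; apply: aeS yE => t yt It.
  by rewrite -yt //; exact: cell_rearr_level.
have vc n : `|v n - c| = `|v' n - yl m|.
  apply: (dist (abs_rrep (v n))).
  - exact: measurable_abs_rrep.
  - by move=> s; exact: normr_ge0.
  - by apply: aeS (v0 n) => t v0t It; rewrite /abs_rrep ger0_norm // v0t.
  - exact: (v'P n).1.
have v'1 n : `|v' n| <= 1 by rewrite (v'P n).2.
have flat' : asymptotically_flat k y v'.
  move=> phi hphi.
  apply: (@squeeze_cvgr _ _ _ _ (fun n => `|z + \sum_(i < k) v (phi i n)|)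
    (cst k.+1%:R)); [|exact: flat|exact: cvg_cst].
  apply: nearW => n; apply/andP; split; last first.
    by apply: (norm_sum_le _ y v'); [rewrite y1|exact: v'1].
  (* Index 0 stands for |x|, which [cell_rearr_level] sends to x^*; the remaining [k] indices stand
     for the chosen terms of the test sequence. *)
  pose f (i : 'I_k.+1) : R -> R :=
    if unlift ord0 i is Some j then abs_rrep (v (phi j n)) else u.
  pose h (i : 'I_k.+1) : R -> R :=
    if unlift ord0 i is Some j then rrep (v' (phi j n)) else rrep y.
  have sumf t : \sum_i f i t = u t + \sum_(i < k) abs_rrep (v (phi i n)) t.
    rewrite big_ord_recl /f unlift_none; congr (_ + _).
    by apply: eq_bigr => i _; rewrite liftK.
  have sumh t : \sum_i h i t = rrep y t + \sum_(i < k) rrep (v' (phi i n)) t.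
    rewrite big_ord_recl /h unlift_none; congr (_ + _).
    by apply: eq_bigr => i _; rewrite liftK.
  have [||||q [qE qn]] := cell_rearr_sum mI I0 lab lab' b mA lab'P hsym hfatou
    f h `|y + \sum_(i < k) v' (phi i n)|.
  - move=> i; rewrite /f; case: (unlift _ _) => [j|] //.
    exact: measurable_abs_rrep.
  - by move=> i s; rewrite /f; case: (unlift _ _) => [j|] //; exact: normr_ge0.
  - have : {ae mu, forall t, forall i, I t ->
        cell_rearr (I := I) lab lab' b (f i) t = (h i t)%:E}.
      apply: ae_forall_count => i; rewrite /f /h; case: (unlift _ _) => [j|].
        exact: (v'P _).1.
      by apply: aeS yE => t yt It; rewrite -yt //; exact: cell_rearr_level.
    by apply: aeS => t fht It i; exact: fht.
  - exists (y + \sum_(i < k) v' (phi i n)); split=> //.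
    apply: aeS (rrepD_sum k y (fun i => v' (phi i n))) => t yt It.
    by rewrite yt // sumh.
  suff -> : z + \sum_(i < k) v (phi i n) = q by [].
  have vabs : {ae mu, forall t, I t -> forall i : 'I_k,
      rrep (v (phi i n)) t = abs_rrep (v (phi i n)) t}.
    have : {ae mu, forall t, forall i : 'I_k, I t ->
        rrep (v (phi i n)) t = abs_rrep (v (phi i n)) t}.
      apply: ae_forall_count => i; apply: aeS (v0 (phi i n)) => t vt It.
      by rewrite /abs_rrep ger0_norm // vt.
    by apply: aeS => t H It i; exact: H.
  have zv : {ae mu, forall t, I t ->
      rrep (z + \sum_(i < k) v (phi i n)) t = \sum_i f i t}.
    apply: aeS3 (rrepD_sum k z (fun i => v (phi i n))) zu vabs => t zt ut vt It.
    rewrite zt // ut // sumf; congr (_ + _); apply: eq_bigr => i _.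
    exact: vt.
  apply: rrep_inj; apply: aeS2 zv qE => t zt qt It.
  by rewrite zt // qt.
have v'y := locally_fully_rotund_le _ _ _ k0 roty v'1 flat'.
have e3 : 0 < e / 3 by rewrite divr_gt0.
have /cvgrPdist_le/(_ _ e3) near_y := v'y.
near=> n.
have : `|0 - `|v' n - y| | <= e / 3 by near: n; exact: near_y.
rewrite !sub0r !normrN !normr_id => vn.
(* Carried to the target cells, the two distances to [c] are those of [v' n] and [y] to [yl m].
   Their sum is at most the distance from [v' n] to [y] plus twice that from [y] to [yl m], whence
   the thirds of [e]. *)
have -> : v n - z = (v n - c) - (z - c) by rewrite opprB subrKA.
apply: le_trans (ler_normB _ _) _; rewrite vc zc.
have -> : v' n - yl m = (v' n - y) + (y - yl m) by rewrite subrKA.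
have := ler_normD (v' n - y) (y - yl m); rewrite [`|y - yl m|]distrC; lra.
Unshelve. all: end_near. Qed.

End rearrangement_rotundity.

(** * Sign changes and the equivalences *)

Section sign.
Context {R : realType} {I : set R}.
Hypothesis mI : measurable I.
Context {E : banach_function_space I}.

Lemma sign_isometry (x : E) : exists T : E -> E,
  [/\ forall y z, T (y + z) = T y + T z, forall y, `|T y| = `|y| &
    forall y, {ae mu, forall t, I t -> rrep (T y) t =
      (if rrep x t < 0 then - rrep y t else rrep y t)}].
Proof.
have /choice[T TP] (y : E) : exists z : E, {ae mu, forall t, I t -> rrep z t =
    (if rrep x t < 0 then - rrep y t else rrep y t)}.
  have [||z [zE _]] :=
      rrep_ideal (fun t => if rrep x t < 0 then - rrep y t else rrep y t) y.
  - apply: measurable_fun_if => //.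
    + apply: measurable_fun_ltr; [exact: measurable_rrep|exact: measurable_cst].
    + by apply: measurable_funN; apply: measurable_funS (measurable_rrep y) => // t [].
    + by apply: measurable_funS (measurable_rrep y) => // t [].
  - by apply: aeW => t It; case: ifP; rewrite ?normrN.
  by exists z.
exists T; split=> //.
- move=> y z; apply: rrep_inj.
  have TS : {ae mu, forall t, I t -> rrep (T y + T z) t =
      (if rrep x t < 0 then - (rrep y t + rrep z t) else rrep y t + rrep z t)}.
    apply: aeS3 (rrepD (T y) (T z)) (TP y) (TP z) => t Tt Ty Tz It.
    by rewrite Tt // Ty // Tz //; case: ifP; rewrite // opprD.
  apply: aeS3 TS (TP (y + z)) (rrepD y z) => t TSt Tyz yz It.
  by rewrite TSt // Tyz // yz.
- move=> y; apply: eq_norm_rrep; apply: aeS (TP y) => t Ty It.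
  by rewrite Ty //; case: ifP; rewrite ?normrN.
Qed.

End sign.

Theorem theorem4p5 (R : realType) (alpha : \bar R)
    (halpha : alpha = 1%E \/ alpha = +oo%E)
    (k : nat) (hk : (2 <= k)%N)
    (E : banach_function_space (interval_to alpha))
    (hsym : symmetric_space E) (hfatou : fatou_property E)
    (x : E) (hx : `|x| = 1) :
  (locally_fully_rotund_at k x <->
   fun_locally_fully_rotund_at E k (fun t => `|rep x t|%E)) /\
  (fun_locally_fully_rotund_at E k (fun t => `|rep x t|%E) <->
   fun_locally_fully_rotund_at E k (rearr (interval_to alpha) (rep x))).
Proof.
have alpha0 : (0 < alpha)%E by case: halpha => ->; rewrite ?lte01 ?ltry.
have mI : measurable (interval_to alpha).
  by apply: measurable_interval_to; exact: ltW.
have k0 : (0 < k)%N by apply: leq_trans hk.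
have [z [zx _]] := rrep_abs x.
have zE : ae_eq mu (interval_to alpha) (rep z) (fun t => `|rep x t|%E).
  by apply: aeS3 (rrepE z) (rrepE x) zx => t zt xt zxt It; rewrite zt // xt // zxt.
have absP : fun_locally_fully_rotund_at E k (fun t => `|rep x t|%E) <->
    locally_fully_rotund_at k z.
  split=> [[y [yE roty]]|rotz]; last by exists z.
  suff -> : z = y by [].
  by apply: rep_inj; apply: ae_eq_trans zE (ae_eq_sym yE).
rewrite absP; split; split.
(* Since rotundity passes back along an isometry, the isometry must send the point of the goal to
   that of the hypothesis. The same sign change sends [z] to [x] here and [x] to [z] in the
   converse. *)
- move=> rotx; have [T [TD Tn TE]] := sign_isometry mI x.
  apply: (locally_fully_rotund_isometry T _ _ TD Tn).
  suff -> : T z = x by [].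
  apply: rrep_inj; apply: aeS2 (TE z) zx => t Tz zxt It.
  rewrite Tz // zxt //.
  by case: ltP => xt; [rewrite ltr0_norm // opprK|rewrite ger0_norm].
- move=> rotz; have [T [TD Tn TE]] := sign_isometry mI x.
  apply: (locally_fully_rotund_isometry T _ _ TD Tn).
  suff -> : T x = z by [].
  apply: rrep_inj; apply: aeS2 (TE x) zx => t Tx zxt It.
  by rewrite Tx // zxt //; case: ltP => xt; [rewrite ltr0_norm|rewrite ger0_norm].
- move=> rotz; have [y [yE _]] := rep_rearr alpha0 hsym x.
  exists y; split=> //.
  have dfin l : 0 < l -> (d_ (interval_to alpha) (rep x) l < +oo)%E.
    move=> l0; rewrite d_rrep //.
    rewrite (_ : mu _ = mu [set s | interval_to alpha s /\ l < `|rrep z s|]).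
      apply: (locally_fully_rotund_distribution_fin mI hsym hfatou _ k) => //.
        by move=> t [].
      by apply: aeS zx => t zxt It; rewrite zxt.
    apply: ae_eq_measure; try exact: measurable_gt_abs (measurable_rrep _).
    by apply: aeS zx => t zxt; split=> /= -[It]; rewrite zxt // normr_id.
  have [T [TD Tn Ty]] := rearr_isometry alpha0 hsym x y z dfin yE zE.
  by apply: (locally_fully_rotund_isometry T _ _ TD Tn); rewrite Ty.
- move=> [y [yE roty]].
  exact: (fully_rotund_of_rearr alpha0 hsym hfatou k x y z).
Qed.
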